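(* Let $T$ be a topological space, for each $t\in T$ let $\mathcal{H}_t$ be a Hilbert space and let $A_t$ be a bounded self-adjoint linear operator on $\mathcal{H}_t$. Then the following are equivalent: (i) the map $t\in T\mapsto \sigma(A_t)$, with values in the closed subsets of $\mathbb{R}$, is continuous for the Vietoris topology; (ii) the spectral edges are continuous, that is, the gap edges of the family $(\sigma(A_t))_{t\in T}$ of compact subsets of $\mathbb{R}$ are continuous; (iii) the field $A=(A_t)_{t\in T}$ is p2-continuous.
   Context: $\sigma(B)$ denotes the spectrum of $B$. p2-continuity: a field $A=(A_t)_{t\in T}$ of bounded self-adjoint operators is p2-continuous if for every polynomial $p$ in one variable with real coefficients and degree at most $2$, the map $t\in T\mapsto \|p(A_t)\|$ is continuous. Vietoris topology: for a topological space $X$, let $\mathscr{C}(X)$ be the set of closed subsets of $X$. For $K\subseteq X$ closed and $\mathcal{F}$ a finite family of open subsets of $X$ let $\mathcal{U}(K,\mathcal{F})=\{F\in\mathscr{C}(X) : K\cap F=\emptyset,\ F\cap O\neq\emptyset \text{ for all } O\in\mathcal{F}\}$. The Vietoris open sets are the unions of sets of the form $\mathcal{U}(K,\mathcal{F})$. Gaps: for a closed $F\subset\mathbb{R}$, a gap of $F$ is a bounded connected component of $\mathbb{R}\setminus F$, i.e. an interval $(a,b)$ with $-\infty<a<b<\infty$, $a,b\in F$, $(a,b)\cap F=\emptyset$. Gap tip: let $(F_t)_{t\in T}$ be a family of closed subsets of $\mathbb{R}$ and $t_0\in T$. A gap tip of $F_{t_0}$ is a point $c\in F_{t_0}$ for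 which there are a non-empty set $U\subset T$ with $t_0\in\overline{U}\setminus U$ and functions $a,b:U\to\mathbb{R}$, $t\mapsto a_t$, $t\mapsto b_t$, with $a_t<b_t$, $\lim_{t\to t_0}a_t=\lim_{t\to t_0}b_t=c$ (limits along $t\in U$), and $(a_t,b_t)$ a gap of $F_t$ for all $t\in U$. Continuity of gap edges: the gap edges of a family $(F_t)_{t\in T}$ of compact subsets of $\mathbb{R}$ are continuous at $t_0\in T$ if all of the following hold: (G1) $t\mapsto\sup F_t$ and $t\mapsto\inf F_t$ are continuous at $t_0$. (G2) For every gap $(a,b)$ of $F_{t_0}$ and every $\epsilon>0$ there is an open neighborhood $U$ of $t_0$ such that for each $t\in U$ there is a gap $(a_t,b_t)$ of $F_t$ with $|a-a_t|<\epsilon$ and $|b-b_t|<\epsilon$. (G3) Whenever $U\subset T$ is a subset (not necessarily open) with $t_0\in\overline{U}\setminus U$ and $a,b:U\to\mathbb{R}$ are maps such that $a_t<b_t$ and $(a_t,b_t)$ is a gap of $F_t$ for all $t\in U$, and the limits $\lim_{t\to t_0}a_t=a$, $\lim_{t\to t_0}b_t=b$ exist in $\mathbb{R}$, then $(a,b)$ is a gap of $F_{t_0}$, which is closed if $a=b$; that is: if $a<b$ then $(a,b)$ is a gap of $F_{t_0}$, and if $a=b$ then this point is a gap tip of $F_{t_0}$. The gap edges are continuous if they are continuous at every $t_0\in T$.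
   Formalization: The implication (ii) ⇒ (i) is stated only for first countable T, as it fails for general T (gap edges are tested along subsets); (i) ⇔ (iii) and (i) ⇒ (ii) hold for every topological space T. *)

(* Defs.v *)
From HB Require Import structures.
From mathcomp Require Import all_boot all_order all_algebra.
From mathcomp Require Import sesquilinear complex.
From mathcomp Require Import all_classical all_reals all_analysis.
Set Implicit Arguments.
Unset Strict Implicit.
Unset Printing Implicit Defensive.
Import Order.TTheory GRing.Theory Num.Theory.
Import numFieldNormedType.Exports.
Local Open Scope classical_set_scope.
Local Open Scope ring_scope.
Local Open Scope complex_scope.

Record closed_subset (X : topologicalType) := ClosedSubset {
  cset :> set X;
  closed_cset : closed cset }.

HB.instance Definition _ (X : topologicalType) := gen_eqMixin (closed_subset X).
HB.instance Definition _ (X : topologicalType) :=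
  gen_choiceMixin (closed_subset X).

Section Vietoris.
Variable X : topologicalType.

(** [KO.1] is the closed set to be missed, [KO.2] the finite family of open sets
    to be hit. *)
Definition vietoris_base (KO : set X * set (set X)) : set (closed_subset X) :=
  [set F | KO.1 `&` F = set0 /\ (forall O, KO.2 O -> F `&` O !=set0)].

Definition vietoris_index : set (set X * set (set X)) :=
  [set KO | [/\ closed KO.1, finite_set KO.2 & KO.2 `<=` @open X]].

Let vietoris_cover : \bigcup_(i in vietoris_index) vietoris_base i = setT.
Proof.
rewrite predeqE => F; split=> // _; exists (set0, set0); last first.
  by split=> //=; rewrite set0I.
by split=> //=; exact: closed0.
Qed.

Let vietoris_join i j F : vietoris_index i -> vietoris_index j ->
  vietoris_base i F -> vietoris_base j F ->
  exists k, [/\ vietoris_index k, vietoris_base k F &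
    vietoris_base k `<=` vietoris_base i `&` vietoris_base j].
Proof.
move=> [ci fi oi] [cj fj oj] [Fi Oi] [Fj Oj].
exists (i.1 `|` j.1, i.2 `|` j.2); split.
- split=> /=; [exact: closedU | by rewrite finite_setU | by rewrite subUset].
- by split=> /=; [rewrite setIUl Fi Fj setU0 | move=> O [/Oi|/Oj]].
- move=> G [/= + GO]; rewrite setIUl setU_eq0 => -[Gi Gj].
  by split; split=> // O HO; apply: GO; [left|right].
Qed.

HB.instance Definition _ := isBaseTopological.Build (closed_subset X)
  vietoris_cover vietoris_join.

End Vietoris.

HB.mixin Record isHilbert (R : realType) H
    of CompleteNormedModule R[i] H := {
  inner : {dot H for (@Num.conj R[i])};
  norm_inner : forall x : H, `|x| ^+ 2 = inner x x }.

#[short(type="hilbertType")]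
HB.structure Definition Hilbert (R : realType) :=
  {H of CompleteNormedModule R[i] H & isHilbert R H}.

Section Operators.
Variables (R : realType) (H : hilbertType R).
Implicit Types (A B : {linear H -> H}) (z : R[i]).

Definition bounded_op A := exists M : R[i], forall x, `|A x| <= M * `|x|.

Definition selfadjoint A := forall x y, inner (A x) y = inner x (A y).

Definition spectrum A : set R[i] :=
  [set z | ~ exists B, [/\ bounded_op B,
    forall x, B (A x - z *: x) = x & forall x, A (B x) - z *: B x = x]].

(** The real points of the spectrum; these are all of the spectrum when [A] is
    bounded and self-adjoint. *)
Definition real_spectrum A : set R := [set x | spectrum A x%:C].

Definition poly_op (p : {poly R}) A (x : H) : H :=
  \sum_(i < size p) (p`_i)%:C *: iter i A x.

(** The norm of a complex normed module is valued in [R[i]]; [Re] only casts it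
    back to [R]. *)
Definition opnorm (f : H -> H) : R :=
  sup [set complex.Re `|f x| | x in [set x : H | `|x| <= 1]].

Lemma bounded_opP A :
  bounded_op A -> exists2 M, 0 < M & forall x, `|A x| <= M * `|x|.
Proof.
move=> [M AM]; exists (`|M| + 1); first by rewrite ltr_wpDl.
move=> x; apply: (le_trans (AM x)).
have [->|x0] := eqVneq x 0; first by rewrite normr0 !mulr0.
have x_gt0 : 0 < `|x| by rewrite normr_gt0.
have M0 : 0 <= M by rewrite -(pmulr_lge0 _ x_gt0); exact: le_trans (AM x).
by rewrite ler_pM2r// ger0_norm// lerDl.
Qed.

Lemma bounded_op_continuous A : bounded_op A -> continuous A.
Proof.
move=> /bounded_opP[M M0 AM]; apply: bounded_linear_continuous.
apply/linear_boundedP; exists M; split; first exact: gtr0_real.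
by move=> r Mr x; rewrite (le_trans (AM x))// ler_wpM2r// ltW.
Qed.

Section Resolvent.
Variables (A B : {linear H -> H}) (z z' M : R[i]).
Hypothesis (BM : forall x, `|B x| <= M * `|x|).
Hypothesis (BA : forall x, B (A x - z *: x) = x).
Hypothesis (AB : forall x, A (B x) - z *: B x = x).
Hypothesis zM : `|z' - z| * M <= 2^-1.

Let d := z' - z.

Let B_contract x y : `|B (d *: x) - B (d *: y)| <= 2^-1 * `|x - y|.
Proof.
rewrite -linearB -scalerBr (le_trans (BM _))// normrZ mulrA.
by rewrite ler_wpM2r// mulrC.
Qed.

Let resolvent_fix w v : v = B (w + d *: v) <-> A v - z' *: v = w.
Proof.
have E : (A v - z' *: v = w) <-> (A v - z *: v = w + d *: v).
  have -> : A v - z *: v = (A v - z' *: v) + d *: v.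
    by rewrite /d scalerBl addrA subrK.
  by split=> [->//|]; exact: addIr.
split=> [Hv|/E Hv]; first by apply/E; rewrite {1 2}Hv AB.
by rewrite -[LHS]BA Hv.
Qed.

Let resolvent_ex w : exists v, A v - z' *: v = w.
Proof.
pose u n := iter n (fun v => B (w + d *: v)) 0.
pose C := `|u 1%N|.
have C0 : 0 <= C by exact: normr_ge0.
have u1 n : `|u n.+1 - u n| <= 2^-1 ^+ n * C.
  elim: n => [|n IH]; first by rewrite subr0 expr0 mul1r.
  have -> : u n.+2 - u n.+1 = B (d *: u n.+1) - B (d *: u n).
    by rewrite -linearB /u !iterS -linearB opprD addrACA subrr add0r.
  by rewrite (le_trans (B_contract _ _))// exprS -mulrA ler_wpM2l.
have uk k n : `|u (n + k)%N - u n| <= 2 * 2^-1 ^+ n * C - 2 * 2^-1 ^+ (n + k) * C.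
  elim: k => [|k IH]; first by rewrite addn0 !subrr normr0.
  rewrite addnS -(subrK (u (n + k)%N) (u _.+1)) -addrA.
  apply: (le_trans (ler_normD _ _)); apply: (le_trans (lerD (u1 _) IH)).
  rewrite le_eqVlt; apply/orP; left; apply/eqP.
  rewrite [in RHS]exprS mulVKf ?pnatr_eq0// addrC -addrA; congr (_ + _).
  by rewrite -mulrA mulr_natl mulr2n opprD subrK.
have uC k n : `|u (n + k)%N - u n| <= 2 * 2^-1 ^+ n * C.
  by apply: (le_trans (uk k n)); rewrite gerBl !mulr_ge0 ?exprn_ge0.
have cu : cvg (u @ \oo).
  apply/cauchy_cvgP/cauchy_exP => e e0; rewrite /cauchy_ex.
  have [n ne] : exists n, 2 * 2^-1 ^+ n * C < e.
    have e'0 : 0 < complex.Re e by move: e0; rewrite ltcE => /andP[].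
    have eE : e = (complex.Re e)%:C by rewrite RRe_real// gtr0_real.
    have CE : C = (complex.Re C)%:C by rewrite RRe_real// ger0_real.
    pose c := 2 * complex.Re C.
    have c0 : 0 <= c.
      by rewrite mulr_ge0//; move: C0; rewrite CE ler0c.
    have [n nce] : exists n, c < complex.Re e * n%:R.
      exists (Num.truncn (c / complex.Re e)).+1.
      by rewrite mulrC -ltr_pdivrMr// truncnS_gt.
    exists n.
    have -> : 2 * 2^-1 ^+ n * C = (c / 2 ^+ n)%:C.
      rewrite {1}CE /c exprVn mulrAC.
      by rewrite !rmorphM fmorphV rmorphXn /= !rmorph_nat.
    rewrite eE ltcR ltr_pdivrMr ?exprn_gt0//.
    apply: (lt_le_trans nce); rewrite ler_pM2l// -natrX ler_nat.
    exact/ltnW/ltn_expl.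
  exists (u n); rewrite /= /nbhs/=; exists n => // m /= nm.
  by rewrite -ball_normE /= distrC -(subnKC nm) (le_lt_trans (uC _ _)).
exists (lim (u @ \oo)); apply/resolvent_fix.
have cB : continuous B by apply: bounded_op_continuous; exists M.
have ul : (fun n => u n.+1) @ \oo --> lim (u @ \oo) by rewrite cvg_shiftS.
have ur : (fun n => u n.+1) @ \oo --> B (w + d *: lim (u @ \oo)).
  apply: (@cvg_comp _ _ _ (fun n => w + d *: u n) B); last exact: cB.
  by apply: cvgD; [exact: cvg_cst | apply: cvgZl_tmp].
exact: cvg_unique ul ur.
Qed.

Lemma resolvent_perturbation : ~ spectrum A z'.
Proof.
apply.
have /choice[S SA] := resolvent_ex.
have inj v : A v - z' *: v = 0 -> v = 0.
  move=> /resolvent_fix; rewrite add0r => vE.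
  apply/eqP; rewrite -normr_le0.
  have := B_contract v 0; rewrite scaler0 linear0 !subr0 -vE.
  rewrite -subr_le0 -[X in X - _]mul1r -mulrBl {1}[1]splitr mul1r addrK.
  by rewrite pmulr_rle0// invr_gt0.
have uniq u v : A u - z' *: u = A v - z' *: v -> u = v.
  move=> uv; apply/eqP; rewrite -subr_eq0; apply/eqP/inj.
  rewrite linearB scalerBr opprD addrACA -opprD.
  by rewrite uv subrr.
have Slin : linear S.
  move=> a u v; apply: uniq; rewrite SA linearP scalerDr scalerA mulrC -scalerA.
  by rewrite opprD addrACA -scalerBr !SA.
pose L : {linear H -> H} := HB.pack S (GRing.isLinear.Build _ _ _ _ S Slin).
exists L; split=> [|x|x] /=; [|by apply: uniq; rewrite SA|exact: SA].
exists (2 * M) => w; rewrite /= -mulrA -ler_pdivrMl//.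
have /resolvent_fix SE := SA w.
have : `|S w| <= M * `|w| + 2^-1 * `|S w|.
  rewrite {1}SE linearD (le_trans (ler_normD _ _))// lerD//.
  by have := B_contract (S w) 0; rewrite scaler0 linear0 !subr0.
rewrite -lerBlDr -[X in X - _]mul1r -mulrBl {1}[1]splitr mul1r.
by rewrite addrK.
Qed.

End Resolvent.

Lemma closed_real_spectrum A : closed (real_spectrum A).
Proof.
rewrite -openC openE => x /contrapT[B [Bb BA AB]].
have [M M0 BM] := bounded_opP Bb.
have ME : M = (complex.Re M)%:C by rewrite RRe_real// gtr0_real.
have M'0 : 0 < complex.Re M by move: M0; rewrite ltcE => /andP[].
have e0 : 0 < (2 * complex.Re M)^-1 by rewrite invr_gt0 mulr_gt0.
exists (2 * complex.Re M)^-1 => //= y; rewrite /= => xy.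
apply: (resolvent_perturbation BM BA AB).
have -> : `|y%:C - x%:C| = `|y - x|%:C :> R[i].
  by rewrite -rmorphB normc_def /= expr0n addr0 sqrtr_sqr.
have -> : 2^-1 = (2^-1 : R)%:C :> R[i] by rewrite fmorphV rmorph_nat.
rewrite ME -rmorphM lecR -ler_pdivlMr// -invfM distrC.
exact: ltW.
Qed.

Definition closed_spectrum A : closed_subset R :=
  ClosedSubset (@closed_real_spectrum A).

End Operators.

Section GapEdges.
Variables (R : realType).

Definition gap (F : set R) (a b : R) :=
  [/\ a < b, F a, F b & `]a, b[ `&` F = set0].

Variables (T : topologicalType) (F : T -> set R).

(** [a] and [b] are only ever evaluated on [U]: the limits are taken along
    [within U (nbhs t0)], and [t0] does not belong to [U]. *)
Definition gap_tip (t0 : T) (c : R) := F t0 c /\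
  exists (U : set T) (a b : T -> R),
  [/\ U !=set0, closure U t0 /\ ~ U t0,
      forall t, U t -> gap (F t) (a t) (b t),
      a t @[t --> within U (nbhs t0)] --> c &
      b t @[t --> within U (nbhs t0)] --> c].

(** Suprema and infima are taken in the extended reals, so that those of the
    empty set (the spectrum on the zero space) are [-oo] and [+oo]. *)
Definition gap_edges_continuous_at (t0 : T) :=
  [/\ {for t0, continuous (fun t => ereal_sup [set x%:E | x in F t])} /\
      {for t0, continuous (fun t => ereal_inf [set x%:E | x in F t])},
      forall a b, gap (F t0) a b -> forall e, 0 < e ->
        exists U : set T, [/\ open U, U t0 & forall t, U t ->
          exists a' b', [/\ gap (F t) a' b', `|a - a'| < e & `|b - b'| < e]] &
      forall (U : set T) (a b : T -> R), closure U t0 -> ~ U t0 ->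
        (forall t, U t -> gap (F t) (a t) (b t)) ->
        forall a0 b0 : R, a t @[t --> within U (nbhs t0)] --> a0 ->
          b t @[t --> within U (nbhs t0)] --> b0 ->
          (a0 < b0 /\ gap (F t0) a0 b0) \/ (a0 = b0 /\ gap_tip t0 a0)].

Definition gap_edges_continuous := forall t0, gap_edges_continuous_at t0.

End GapEdges.

Definition p2_continuous (R : realType) (T : topologicalType)
    (H : T -> hilbertType R) (A : forall t, {linear H t -> H t}) :=
  forall p : {poly R}, (size p <= 3)%N ->
    continuous (fun t => opnorm (poly_op p (A t))).

(** Gap edges are tested along subsets of [T], not along nets, so that over a
    space that is not first countable their continuity does not imply that of
    the spectrum: take [T = [0, 1]] with a point [w] added, the points of
    [[0, 1]] isolated, the neighbourhoods of [w] co-countable, and spectra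
    [[-10, 10] \ ]t, t + 1[] at [t] and [[-10, 10]] at [w]. *)
Definition first_countable (T : topologicalType) :=
  forall t : T, exists V : nat -> set T, (forall n, nbhs t (V n)) /\
    forall N, nbhs t N -> exists n, V n `<=` N.

(* Main.v *)
Require Import Defs.
From HB Require Import structures.
From mathcomp Require Import all_boot all_order all_algebra.
From mathcomp Require Import sesquilinear complex.
From mathcomp Require Import all_classical all_reals all_analysis.
From mathcomp Require Import lra ring.
Set Implicit Arguments.
Unset Strict Implicit.
Unset Printing Implicit Defensive.
Import Order.TTheory GRing.Theory Num.Theory.
Import numFieldNormedType.Exports.
Local Open Scope classical_set_scope.
Local Open Scope ring_scope.

(** Everything reduces to one spectral fact and to elementary topology of
    closed subsets of the line.

    The spectral fact is [opnorm_poly_op_le]: for a bounded self-adjoint [A], a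
    real polynomial [p] and [c >= 0], one has [opnorm (p(A)) <= c] iff [|p| <= c]
    on the real spectrum of [A].  It rests on the description of the resolvent
    set as the set of [z] for which [A - z] is bounded below: a self-adjoint [S]
    that is bounded below is onto, because [x |-> x - e (S (S x) - y)] is a
    contraction for small [e > 0] ([bounded_below_surjective]), and [A - z] is
    always bounded below for nonreal [z].  Put [m = opnorm (p(A))].  Vectors
    that almost realize this norm show that [p(A)^2 - m^2] is not bounded below
    ([opnorm_not_bounded_below]).  Since a product of operators bounded below
    is bounded below, splitting [p^2 - m^2] into linear factors over the complex
    numbers gives a root of it in the real spectrum, where [|p| = m]
    ([opnorm_attained]).  Conversely [p - p(x)] is a multiple of [X - x], hence
    [p(A)] almost multiplies by [p(x)] the vectors that [A - x] almost kills
    ([norm_horner_le_opnorm]).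

    Vietoris continuity at [t0] means that an open set met by the spectrum at
    [t0] is met by the nearby spectra, and that a closed set missed at [t0] is
    missed nearby ([vietoris_continuousP]).

    - Vietoris continuity makes [|p|] on the spectrum, hence the norms,
      continuous.  Conversely the polynomial [C - (X - x)^2], with [C] large,
      has norm [C - d^2], where [d] is the distance from [x] to the spectrum; so
      these distances are continuous, and compactness does the rest.

    - Vietoris continuity gives that of the gap edges: hit small windows around
      the two ends of a gap and miss the segment between them; conversely a
      point of the spectrum strictly inside a limit of gaps would be approached
      by the nearby spectra, which avoid these gaps.

    - Suppose that the gap edges are continuous.  A point outside the spectrum
      at [t0] is either beyond its extremities or in a gap, and stays outside
      nearby.  If on the other hand a point [x] of the spectrum at [t0] were not
      approached by nearby spectra, then [x] would lie well inside a gap of the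
      spectra at parameters accumulating at [t0]; first countability extracts a
      set of parameters along which these gaps converge, and the limit is a gap
      of the spectrum at [t0] that contains [x]. *)

(** * The underlying real inner product space *)

Section ComplexRe.
Variable R : realType.
Implicit Types (a : R) (u v : R[i]).
Local Open Scope complex_scope.

Lemma ReD u v : complex.Re (u + v) = complex.Re u + complex.Re v.
Proof. by case: u v => a b [c d]. Qed.

Lemma ReN u : complex.Re (- u) = - complex.Re u.
Proof. by case: u. Qed.

Lemma ReMr a u : complex.Re (a%:C * u) = a * complex.Re u.
Proof. by case: u => b c /=; rewrite mul0r subr0. Qed.

Lemma ReMi b u : complex.Re ((0 +i* b) * u) = - (b * complex.Im u).
Proof. by case: u => c d /=; rewrite mul0r sub0r. Qed.

End ComplexRe.

(** Self-adjointness, boundedness and lower bounds only involve the real part of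
    the inner product, which keeps all the estimates among real numbers. *)
Section RealNorm.
Variables (R : realType) (H : hilbertType R).
Implicit Types x y : H.
Local Open Scope complex_scope.

Definition rnorm x : R := complex.Re `|x|.

Definition rinner x y : R := complex.Re (inner x y).

Lemma rnormE x : (rnorm x)%:C = `|x|.
Proof. exact/RRe_real/ger0_real/normr_ge0. Qed.

Lemma rnorm_ge0 x : 0 <= rnorm x.
Proof. by rewrite -ler0c rnormE. Qed.

Lemma rnorm0 : rnorm 0 = 0.
Proof. by rewrite /rnorm normr0. Qed.

Lemma rnorm_eq0 x : rnorm x = 0 -> x = 0.
Proof.
by move=> x0; apply/eqP; rewrite -normr_eq0 -rnormE x0.
Qed.

Lemma rnormD x y : rnorm (x + y) <= rnorm x + rnorm y.
Proof. by rewrite -lecR rmorphD /= !rnormE ler_normD. Qed.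

Lemma rnormN x : rnorm (- x) = rnorm x.
Proof. by rewrite /rnorm normrN. Qed.

Lemma rnormZ (a : R[i]) x : rnorm (a *: x) = complex.Re `|a| * rnorm x.
Proof.
have aE : (complex.Re `|a|)%:C = `|a| by exact/RRe_real/ger0_real.
by apply: (@complexI R); rewrite rmorphM [LHS]rnormE normrZ -aE -[in LHS]rnormE.
Qed.

Lemma rnormZr (a : R) x : rnorm (a%:C *: x) = `|a| * rnorm x.
Proof. by rewrite rnormZ normc_def /= expr0n addr0 sqrtr_sqr. Qed.

Lemma innerC x y : inner x y = (inner y x)^*%C.
Proof. by rewrite [LHS](@hermC _ _ _ _ inner) expr0 mul1r. Qed.

Lemma rinnerC x y : rinner x y = rinner y x.
Proof. by rewrite /rinner innerC; case: (inner y x). Qed.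

Lemma rinnerDl x y z : rinner (x + y) z = rinner x z + rinner y z.
Proof.
by rewrite /rinner linearDl; exact: ReD.
Qed.

Lemma rinnerNl x y : rinner (- x) y = - rinner x y.
Proof. by rewrite /rinner linearNl; exact: ReN. Qed.

Lemma rinnerZl (a : R) x y : rinner (a%:C *: x) y = a * rinner x y.
Proof.
by rewrite /rinner linearZl_LR; exact: ReMr.
Qed.

Lemma rinnerZil (b : R) x y :
  rinner ((0 +i* b) *: x) y = - rinner x ((0 +i* b) *: y).
Proof.
have E u v : rinner ((0 +i* b) *: u) v = - (b * complex.Im (inner u v)).
  by rewrite /rinner linearZl_LR; exact: ReMi.
have yx : complex.Im (inner y x) = - complex.Im (inner x y).
  by rewrite innerC; case: (inner x y).
by rewrite [in RHS]rinnerC !E yx mulrN opprK.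
Qed.

Lemma sqr_rnorm x : rnorm x ^+ 2 = rinner x x.
Proof.
have xE : (rinner x x)%:C = inner x x.
  by apply/RRe_real/ger0_real; rewrite -norm_inner exprn_ge0.
by apply: (@complexI R); rewrite rmorphXn [RHS]xE -norm_inner -[in RHS]rnormE.
Qed.

Lemma sqr_rnormD x y :
  rnorm (x + y) ^+ 2 = rnorm x ^+ 2 + rnorm y ^+ 2 + 2 * rinner x y.
Proof.
rewrite !sqr_rnorm rinnerDl ![rinner _ (x + y)]rinnerC !rinnerDl (rinnerC y x).
by ring.
Qed.

End RealNorm.

(** * Operators bounded below *)

Section Contraction.
Variables (R : realType) (H : hilbertType R).
Local Open Scope complex_scope.

Lemma contraction_fixed_point (f : H -> H) (q : R) : 0 <= q -> q < 1 ->
  (forall x y, rnorm (f x - f y) <= q * rnorm (x - y)) -> exists v, f v = v.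
Proof.
move=> q0 q1 fq.
pose u n := iter n f 0.
pose D := rnorm (f 0) / (1 - q).
have DE : rnorm (f 0) + q * D = D by rewrite /D; field; lra.
have uD k : rnorm (u k) <= D.
  elim: k => [|k IH].
    by rewrite rnorm0 divr_ge0 ?rnorm_ge0 ?subr_ge0 ?ltW.
  rewrite /u iterS -/(u k) -(subrK (f 0) (f (u k))) -DE addrC.
  apply: (le_trans (rnormD _ _)); rewrite lerD2l (le_trans (fq _ _))// subr0.
  by rewrite ler_wpM2l.
have uC n k : rnorm (u (n + k)%N - u n) <= q ^+ n * D.
  elim: n => [|n IH]; first by rewrite subr0 mul1r.
  rewrite addSn /u !iterS -/(u n) -/(u (n + k)%N) (le_trans (fq _ _))//.
  by rewrite exprS -mulrA ler_wpM2l.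
have cu : cvg (u @ \oo).
  apply/cauchy_cvgP/cauchy_exP => e e0; rewrite /cauchy_ex.
  have e'0 : 0 < complex.Re e by move: e0; rewrite ltcE => /andP[].
  have eE : (complex.Re e)%:C = e by exact/RRe_real/gtr0_real.
  have qD : q ^+ n * D @[n --> \oo] --> 0.
    rewrite -[X in _ --> X](mul0r D); apply: cvgMl; apply: cvg_expr.
    by rewrite ger0_norm.
  have [n _ /(_ n (leqnn n)) /= nqD] := cvgr_lt _ qD _ e'0.
  exists (u n); exists n => // m /= nm.
  rewrite -ball_normE /= distrC -(subnKC nm) -rnormE -eE ltcR.
  exact: le_lt_trans (uC _ _) nqD.
exists (lim (u @ \oo)); set l := lim _.
have ul : (fun n => u n.+1) @ \oo --> l by rewrite cvg_shiftS.
suff ufl : (fun n => u n.+1) @ \oo --> f l by exact: cvg_unique ufl ul.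
apply/cvgrPdist_lt => e e0; have /cvgrPdist_lt/(_ e e0) := cu.
apply: filterS => n; apply: le_lt_trans; rewrite -!rnormE lecR.
by rewrite (le_trans (fq _ _))// ler_piMl ?rnorm_ge0 ?ltW.
Qed.

End Contraction.

Section BoundedBelow.
Variables (R : realType) (H : hilbertType R).
Implicit Types (S : H -> H) (A : {linear H -> H}).
Local Open Scope complex_scope.

Definition rbounded S :=
  exists2 M : R, 0 < M & forall x, rnorm (S x) <= M * rnorm x.

Definition bounded_below S :=
  exists2 d : R, 0 < d & forall x, d * rnorm x <= rnorm (S x).

Lemma bounded_op_rbounded A : bounded_op A -> rbounded A.
Proof.
move=> /bounded_opP[M M0 AM]; exists (complex.Re M).
  by move: M0; rewrite ltcE => /andP[].
have ME : (complex.Re M)%:C = M by exact/RRe_real/gtr0_real.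
by move=> x; rewrite -lecR rmorphM [leLHS]rnormE /= ME [X in _ <= _ * X]rnormE.
Qed.

Lemma selfadjoint_rinner A : selfadjoint A ->
  forall x y, rinner (A x) y = rinner x (A y).
Proof. by move=> As x y; rewrite /rinner As. Qed.

(** With [M] a bound of [S] and [e = 1/M^2], the vector [w - e S (S w)] has
    squared norm at most [|w|^2 - e |S w|^2 <= (1 - e d^2) |w|^2]: the map
    [v |-> v - e (S (S v) - y)] is a contraction, and the image by [S] of its
    fixed point is a preimage of [y]. *)
Lemma bounded_below_surjective S : {morph S : x y / x - y} ->
  rbounded S -> (forall x y, rinner (S x) y = rinner x (S y)) ->
  bounded_below S -> forall y, exists x, S x = y.
Proof.
move=> SB [M0 M0_gt0 SM0] Ss [d d0 Sd] y.
(* Adding [d] makes [M > d], even on the zero space. *)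
pose M := M0 + d.
have M_gt0 : 0 < M by exact: addr_gt0.
have SM x : rnorm (S x) <= M * rnorm x.
  by rewrite (le_trans (SM0 x))// ler_wpM2r ?rnorm_ge0// lerDl ltW.
pose e := (M ^+ 2)^-1.
have e0 : 0 < e by rewrite invr_gt0 exprn_gt0.
pose t := e * d ^+ 2.
have t0 : 0 < t by rewrite mulr_gt0// exprn_gt0.
have t1 : t < 1.
  rewrite /t /e mulrC ltr_pdivrMr ?exprn_gt0// mul1r ltrXn2r ?nnegrE ?ltW//.
  by rewrite /M ltrDr.
(* The contraction ratio [1 - t / 2] satisfies [1 - t <= (1 - t / 2) ^+ 2]. *)
pose f v := v + (- e)%:C *: (S (S v) - y).
have [||x x'|v fv] := @contraction_fixed_point R H f (1 - t / 2).
- lra.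
- lra.
- have -> : f x - f x' = (x - x') + (- e)%:C *: S (S (x - x')).
    by rewrite /f !SB opprD addrACA -scalerBr opprD opprK addrACA addNr addr0.
  set w := x - x'; have q0 : 0 <= 1 - t / 2 by lra.
  rewrite -(ler_pXn2r (n := 2)) ?nnegrE ?mulr_ge0 ?rnorm_ge0//.
  rewrite sqr_rnormD rnormZr normrN (gtr0_norm e0) rinnerC rinnerZl Ss -sqr_rnorm.
  have := Sd w; have := SM (S w); move: (rnorm_ge0 w) (rnorm_ge0 (S w)).
  have := rnorm_ge0 (S (S w)).
  move: (rnorm w) (rnorm (S w)) (rnorm (S (S w))) => a b c c0 a0 b0 cM bd.
  have c2 : (e * c) ^+ 2 <= e * b ^+ 2.
    have : c ^+ 2 <= (M * b) ^+ 2 by rewrite ler_pXn2r ?nnegrE ?mulr_ge0// ltW.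
    rewrite -(ler_pM2l e0).
    have -> : e * (M * b) ^+ 2 = b ^+ 2 by rewrite /e; field; lra.
    by rewrite exprMn expr2 -mulrA ler_pM2l.
  have b2 : (d * a) ^+ 2 <= b ^+ 2 by rewrite ler_pXn2r ?nnegrE ?mulr_ge0// ltW.
  have eb2 : t * a ^+ 2 <= e * b ^+ 2.
    by move: b2; rewrite exprMn -(ler_pM2l e0) /t mulrA.
  have : 0 <= (t / 2 * a) ^+ 2 by exact: sqr_ge0.
  have -> : ((1 - t / 2) * a) ^+ 2 = a ^+ 2 - t * a ^+ 2 + (t / 2 * a) ^+ 2.
    by field.
  lra.
exists (S v); move: fv; rewrite /f => /eqP.
rewrite -subr_eq0 addrAC subrr add0r scaler_eq0 => /orP[|].
  by move=> /eqP/(congr1 (@complex.Re R)) /= /eqP; rewrite oppr_eq0 gt_eqF.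
by rewrite subr_eq0 => /eqP.
Qed.

Lemma bijective_notin_spectrum A z :
  bounded_below (fun x => A x - z *: x) ->
  (forall y, exists x, A x - z *: x = y) -> ~ spectrum A z.
Proof.
move=> [d d0 Ad] /choice[B AB]; apply.
have inj u v : A u - z *: u = A v - z *: v -> u = v.
  move=> uv; apply/eqP; rewrite -subr_eq0; apply/eqP/rnorm_eq0.
  have := Ad (u - v); rewrite linearB scalerBr opprD addrACA -opprD uv subrr.
  rewrite rnorm0 pmulr_rle0// => uv0; apply/eqP.
  by rewrite eq_le uv0 rnorm_ge0.
have Blin : linear B.
  move=> a u v; apply: inj; rewrite AB linearP scalerDr scalerA mulrC -scalerA.
  by rewrite opprD addrACA -scalerBr !AB.
pose L : {linear H -> H} := HB.pack B (GRing.isLinear.Build _ _ _ _ B Blin).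
exists L; split=> [|x|x] /=; [|by apply: inj; rewrite AB|exact: AB].
exists (d^-1)%:C => w /=; rewrite -!rnormE -rmorphM lecR.
by rewrite ler_pdivlMl// (le_trans (Ad _))// AB.
Qed.

Lemma resolvent_bounded_below A z :
  ~ spectrum A z -> bounded_below (fun x => A x - z *: x).
Proof.
move=> /contrapT[B [/bounded_op_rbounded[M M0 BM] BA _]].
exists M^-1; first by rewrite invr_gt0.
by move=> x; rewrite ler_pdivrMl// -{1}(BA x).
Qed.

Lemma rinner_subr A (a : R) : selfadjoint A -> forall u v,
  rinner (A u - a%:C *: u) v = rinner u (A v - a%:C *: v).
Proof.
move=> /selfadjoint_rinner As u v.
rewrite [RHS]rinnerC !rinnerDl !rinnerNl !rinnerZl (As u v).
by rewrite (rinnerC (A v)) (rinnerC v u).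
Qed.

(** For a self-adjoint operator surjectivity comes for free, so that every point
    of the spectrum is an approximate eigenvalue. *)
Lemma real_spectrumP A x : bounded_op A -> selfadjoint A ->
  real_spectrum A x <-> ~ bounded_below (fun u => A u - x%:C *: u).
Proof.
move=> /bounded_op_rbounded[M M0 AM] As; split; last first.
  by move=> Ax; apply: contrapT => /resolvent_bounded_below.
move=> + Ax; apply: bijective_notin_spectrum => //.
apply: bounded_below_surjective => //.
- by move=> u v; rewrite linearB scalerBr !opprD addrACA.
- exists (M + `|x|) => [|u]; first by rewrite ltr_pwDl.
  by rewrite mulrDl (le_trans (rnormD _ _))// rnormN rnormZr lerD2r.
- exact: rinner_subr.
Qed.

End BoundedBelow.

(** * Polynomials of an operator *)

Section PolynomialCalculus.
Variables (R : realType) (H : hilbertType R).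
Implicit Types (A : {linear H -> H}) (p q : {poly R[i]}).
Local Open Scope complex_scope.

(** Complex coefficients are needed to split polynomials into linear factors. *)
Definition cpoly_op p A (x : H) : H := \sum_(i < size p) p`_i *: iter i A x.

Lemma poly_opE (p : {poly R}) A x :
  poly_op p A x = cpoly_op (map_poly (real_complex R) p) A x.
Proof.
rewrite /poly_op /cpoly_op size_map_poly; apply: eq_bigr => i _.
by rewrite coef_map.
Qed.

Lemma cpoly_op_widen p A x n : (size p <= n)%N ->
  cpoly_op p A x = \sum_(i < n) p`_i *: iter i A x.
Proof.
move=> pn; rewrite /cpoly_op (big_ord_widen n (fun i => p`_i *: iter i A x))//.
rewrite big_mkcond /=; apply: eq_bigr => i _; case: ltnP => // ip.
by rewrite nth_default// scale0r.
Qed.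

Lemma cpoly_opD p q A x : cpoly_op (p + q) A x = cpoly_op p A x + cpoly_op q A x.
Proof.
pose n := maxn (size p) (size q).
rewrite (cpoly_op_widen _ _ (size_polyD p q)) -/n.
rewrite (cpoly_op_widen A x (leq_maxl _ _ : size p <= n)%N).
rewrite (cpoly_op_widen A x (leq_maxr _ _ : size q <= n)%N).
by rewrite -big_split; apply: eq_bigr => i _; rewrite coefD scalerDl.
Qed.

Lemma cpoly_opZ c p A x : cpoly_op (c *: p) A x = c *: cpoly_op p A x.
Proof.
rewrite (cpoly_op_widen _ _ (size_scale_leq c p)) scaler_sumr.
by apply: eq_bigr => i _; rewrite coefZ scalerA.
Qed.

Lemma cpoly_opC c A x : cpoly_op c%:P A x = c *: x.
Proof.
by rewrite (cpoly_op_widen _ _ (size_polyC_leq1 c)) big_ord1 coefC.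
Qed.

Lemma cpoly_opMX p A x : cpoly_op (p * 'X) A x = A (cpoly_op p A x).
Proof.
have pX : (size (p * 'X)%R <= (size p).+1)%N.
  by rewrite (leq_trans (size_polyMleq _ _))// size_polyX addn2.
rewrite (cpoly_op_widen _ _ pX) big_ord_recl coefMX scale0r add0r linear_sum.
by apply: eq_bigr => i _; rewrite coefMX /= linearZ.
Qed.

Lemma cpoly_opX A x : cpoly_op 'X A x = A x.
Proof. by rewrite -['X]mul1r cpoly_opMX -polyC1 cpoly_opC scale1r. Qed.

Lemma cpoly_opM p q A x : cpoly_op (p * q) A x = cpoly_op p A (cpoly_op q A x).
Proof.
elim/poly_ind: p => [|p c IH].
  by rewrite mul0r -polyC0 !cpoly_opC !scale0r.
rewrite mulrDl mulrAC !cpoly_opD !cpoly_opMX IH mul_polyC cpoly_opZ.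
by rewrite cpoly_opC.
Qed.

Lemma cpoly_op_XsubC c A x : cpoly_op ('X - c%:P) A x = A x - c *: x.
Proof.
by rewrite -polyCN cpoly_opD cpoly_opC scaleNr cpoly_opX.
Qed.

Lemma linear_cpoly_op p A : linear (cpoly_op p A).
Proof.
move=> a x y; elim/poly_ind: p => [|p c IH].
  by rewrite -polyC0 !cpoly_opC !scale0r scaler0 addr0.
rewrite !cpoly_opD !cpoly_opMX !cpoly_opC IH linearP !scalerDr addrACA.
by rewrite !scalerA (mulrC c).
Qed.

Lemma rbounded_cpoly_op p A : rbounded A -> rbounded (cpoly_op p A).
Proof.
move=> [M M0 AM]; elim/poly_ind: p => [|p c [N N0 pN]].
  by exists 1 => // x; rewrite -polyC0 cpoly_opC scale0r rnorm0 mul1r rnorm_ge0.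
have c0 : 0 <= complex.Re `|c|.
  by have : 0 <= `|c| by []; rewrite lecE => /andP[].
exists (M * N + complex.Re `|c|) => [|x]; first by rewrite ltr_pwDl// mulr_gt0.
rewrite cpoly_opD cpoly_opMX cpoly_opC (le_trans (rnormD _ _))//.
rewrite rnormZ mulrDl lerD2r (le_trans (AM _))// -mulrA.
by rewrite ler_pM2l.
Qed.

Lemma selfadjoint_poly_op (p : {poly R}) A : selfadjoint A ->
  forall x y, rinner (poly_op p A x) y = rinner x (poly_op p A y).
Proof.
move=> /selfadjoint_rinner As; elim/poly_ind: p => [|p c IH] x y.
  rewrite !poly_opE rmorph0 -polyC0 !cpoly_opC !scale0r.
  by rewrite /rinner linear0l linear0r.
rewrite !poly_opE rmorphD rmorphM /= map_polyX map_polyC /=.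
rewrite !cpoly_opD !cpoly_opMX !cpoly_opC -!poly_opE.
rewrite [RHS]rinnerC !rinnerDl !rinnerZl As IH (rinnerC y x); congr (_ + _).
by rewrite rinnerC !poly_opE -[A y in LHS]cpoly_opX -cpoly_opM cpoly_opMX.
Qed.

(** With [z = a + i b], the vectors [(A - a) u] and [i b u] are orthogonal for
    the real inner product. *)
Lemma bounded_below_nonreal A z : selfadjoint A -> complex.Im z != 0 ->
  bounded_below (fun u => A u - z *: u).
Proof.
case: z => a b /= As b0; exists `|b| => [|u]; first by rewrite normr_gt0.
pose S v := A v - a%:C *: v.
have -> : A u - (a +i* b) *: u = S u - (0 +i* b) *: u.
  rewrite /S -addrA -opprD -scalerDl; congr (_ - _ *: _).
  by rewrite /GRing.add /= addr0 add0r.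
have Ss : forall v w, rinner (S v) w = rinner v (S w) by exact: rinner_subr.
have Si : S ((0 +i* b) *: u) = (0 +i* b) *: S u.
  by rewrite /S linearZ scalerBr !scalerA mulrC.
(* [S] commutes with multiplication by [i b], which is skew for the real inner
   product, so that the cross term equals its opposite. *)
have /eqP : rinner (S u) ((0 +i* b) *: u) = - rinner (S u) ((0 +i* b) *: u).
  by rewrite {1}Ss Si rinnerC rinnerZil.
rewrite -subr_eq0 opprK -mulr2n mulrn_eq0 /= => /eqP Su0.
rewrite -(ler_pXn2r (n := 2)) ?nnegrE ?mulr_ge0 ?rnorm_ge0//.
rewrite sqr_rnormD rnormN rnormZ rinnerC rinnerNl rinnerC Su0.
have -> : complex.Re `|0 +i* b : R[i]| = `|b|.
  by rewrite normc_def /= expr0n add0r sqrtr_sqr.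
have := sqr_ge0 (rnorm (S u)); lra.
Qed.

(** A product of operators bounded below is bounded below: split [p] into linear
    factors. *)
Lemma bounded_below_cpoly_op p A : p != 0 ->
  (forall z, root p z -> bounded_below (fun u => A u - z *: u)) ->
  bounded_below (cpoly_op p A).
Proof.
move=> p0; have [rs pE] := closed_field_poly_normal p.
move=> pA; have {pA} : forall z, z \in rs -> bounded_below (fun u => A u - z *: u).
  by move=> z zrs; apply: pA; rewrite pE rootZ ?lead_coef_eq0// root_prod_XsubC.
move: p0; rewrite -lead_coef_eq0 => c0; rewrite pE.
move: (lead_coef p) c0 => c c0 {p pE} rsA.
have {}c0 : 0 < complex.Re `|c|.
  by move: c0; rewrite -normr_gt0 ltcE => /andP[].
suff [d d0 dP] : bounded_below (cpoly_op (\prod_(z <- rs) ('X - z%:P)) A).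
  exists (complex.Re `|c| * d) => [|u]; first exact: mulr_gt0.
  by rewrite cpoly_opZ rnormZ -mulrA ler_pM2l.
elim: rs rsA => [_|z rs IH rsA].
  by exists 1 => // u; rewrite big_nil -polyC1 cpoly_opC scale1r mul1r.
have [d d0 dA] := rsA z (mem_head _ _).
have [|e e0 eP] := IH; first by move=> y yrs; apply: rsA; rewrite inE yrs orbT.
exists (d * e) => [|u]; first exact: mulr_gt0.
rewrite big_cons cpoly_opM cpoly_op_XsubC (le_trans _ (dA _))// -mulrA.
by rewrite ler_pM2l.
Qed.

(** This replaces the spectral mapping theorem: a factor of [p] over the complex
    numbers must fail to be bounded below, and it comes from a real root because
    of [bounded_below_nonreal]. *)
Lemma root_in_spectrum (p : {poly R}) A : bounded_op A -> selfadjoint A ->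
  p != 0 -> ~ bounded_below (poly_op p A) ->
  exists2 r, real_spectrum A r & root p r.
Proof.
move=> Ab As p0 pA; apply: contrapT => pr; apply: pA.
have -> : poly_op p A = cpoly_op (map_poly (real_complex R) p) A.
  by apply/funext => x; rewrite poly_opE.
apply: bounded_below_cpoly_op; first by rewrite map_poly_eq0.
move=> z pz; have [|z0] := eqVneq (complex.Im z) 0; last first.
  exact: bounded_below_nonreal.
case: z pz => a b /= + b0; rewrite b0 => pa; apply: contrapT.
move=> /(real_spectrumP a Ab As) Aa; apply: pr; exists a => //.
by move: pa; rewrite -[a +i* 0]/(real_complex R a) fmorph_root.
Qed.

End PolynomialCalculus.

(** * The norm of a polynomial of a self-adjoint operator *)

Section SpectralNorm.
Variables (R : realType) (H : hilbertType R).
Implicit Types (A : {linear H -> H}) (p q : {poly R}).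
Local Open Scope complex_scope.

Lemma poly_opD p q A x : poly_op (p + q) A x = poly_op p A x + poly_op q A x.
Proof. by rewrite !poly_opE rmorphD cpoly_opD. Qed.

Lemma poly_opC c A x : poly_op c%:P A x = c%:C *: x.
Proof. by rewrite poly_opE map_polyC cpoly_opC. Qed.

Lemma poly_opX A x : poly_op 'X A x = A x.
Proof. by rewrite poly_opE map_polyX cpoly_opX. Qed.

Lemma poly_opM p q A x : poly_op (p * q) A x = poly_op p A (poly_op q A x).
Proof. by rewrite !poly_opE rmorphM cpoly_opM. Qed.

Lemma linear_poly_op p A : linear (poly_op p A).
Proof. by move=> a x y; rewrite !poly_opE linear_cpoly_op. Qed.

HB.instance Definition _ p A :=
  GRing.isLinear.Build _ _ _ _ (poly_op p A) (linear_poly_op p A).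

Lemma rbounded_poly_op p A : rbounded A -> rbounded (poly_op p A).
Proof.
move=> /(rbounded_cpoly_op (map_poly (real_complex R) p))[M M0 pM].
by exists M => // x; rewrite poly_opE.
Qed.

Lemma opnorm_le A c : rbounded A -> 0 <= c ->
  opnorm A <= c <-> forall x, rnorm (A x) <= c * rnorm x.
Proof.
move=> [M M0 AM] c0; rewrite /opnorm; set E := (X in sup X).
have ball x : (`|x| <= 1) = (rnorm x <= 1) by rewrite -rnormE lecR.
have E0 : E !=set0 by exists (rnorm (A 0)), 0 => //=; rewrite ball rnorm0.
split=> [Ac x|Ac]; last first.
  apply: ge_sup => // _ [x /= + <-]; rewrite ball => x1.
  by rewrite (le_trans (Ac x))// ler_piMr.
have [x0|x0] := eqVneq (rnorm x) 0.
  by rewrite (rnorm_eq0 x0) linear0 rnorm0 mulr0.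
have {}x0 : 0 < rnorm x by rewrite lt_def x0 rnorm_ge0.
rewrite -ler_pdivrMr// mulrC; apply: le_trans Ac; apply: ub_le_sup.
  exists M => _ [y /= + <-]; rewrite ball => y1.
  by rewrite (le_trans (AM y))// ler_piMr// ltW.
exists ((rnorm x)^-1%:C *: x) => /=.
  by rewrite ball rnormZr gtr0_norm ?invr_gt0// mulVf ?gt_eqF.
by rewrite linearZ -/(rnorm _) rnormZr gtr0_norm// invr_gt0.
Qed.

Lemma opnorm_ge0 A : rbounded A -> 0 <= opnorm A.
Proof.
move=> [M M0 AM]; apply: le_trans (_ : rnorm (A 0) <= _).
  exact: rnorm_ge0.
have ball x : (`|x| <= 1) = (rnorm x <= 1) by rewrite -rnormE lecR.
apply: ub_le_sup; last by exists 0 => //=; rewrite ball rnorm0.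
exists M => _ [y /= + <-]; rewrite ball => y1.
by rewrite (le_trans (AM y))// ler_piMr// ltW.
Qed.

(** With [Q = p(A)] and [m] its norm, the vector [Q (Q x) - m^2 x] has squared
    norm at most [m^4 |x|^2 - m^2 |Q x|^2], which is small compared with [|x|^2]
    as soon as [|Q x|] is close to [m |x|]. *)
Lemma opnorm_not_bounded_below p A : bounded_op A -> selfadjoint A ->
  (exists u : H, u != 0) ->
  ~ bounded_below (poly_op (p ^+ 2 - (opnorm (poly_op p A) ^+ 2)%:P) A).
Proof.
move=> /bounded_op_rbounded Ab As [u u0] [d d0].
have Qb := rbounded_poly_op p Ab.
set m := opnorm _; have m0 : 0 <= m := opnorm_ge0 Qb.
have Qm : forall x, rnorm (poly_op p A x) <= m * rnorm x.
  exact/(opnorm_le Qb).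
set Q := poly_op p A in Qb Qm *.
have PE x : poly_op (p ^+ 2 - (m ^+ 2)%:P) A x = Q (Q x) - (m ^+ 2)%:C *: x.
  by rewrite -polyCN poly_opD poly_opC poly_opM rmorphN scaleNr.
move=> dP.
(* A lower bound [d] would bound [Q] by [sqrt (m^2 - d^2 / m^2) < m]. *)
have key x : d ^+ 2 * rnorm x ^+ 2 <=
    m ^+ 4 * rnorm x ^+ 2 - m ^+ 2 * rnorm (Q x) ^+ 2.
  have := dP x; rewrite -(ler_pXn2r (n := 2)) ?nnegrE ?rnorm_ge0//; last first.
    by rewrite mulr_ge0 ?rnorm_ge0// ltW.
  rewrite exprMn => /le_trans; apply; rewrite PE sqr_rnormD rnormN rnormZr.
  rewrite rinnerC rinnerNl rinnerZl -(selfadjoint_poly_op p As) -sqr_rnorm.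
  rewrite ger0_norm ?sqr_ge0//.
  have : rnorm (Q (Q x)) ^+ 2 <= (m * rnorm (Q x)) ^+ 2.
    by rewrite ler_pXn2r ?nnegrE ?mulr_ge0 ?rnorm_ge0.
  rewrite !exprMn -exprD -/(Q x); lra.
have u_gt0 : 0 < rnorm u.
  by rewrite lt_def rnorm_ge0 andbT; apply: contra_neq u0 => /rnorm_eq0.
have [m_eq0|m_neq0] := eqVneq m 0.
  have := key u; rewrite m_eq0 !expr0n !mul0r subr0 leNgt mulr_gt0 ?exprn_gt0//.
have {m_neq0}m_gt0 : 0 < m by rewrite lt_def m_neq0.
pose s := m ^+ 2 - d ^+ 2 / m ^+ 2.
have ms : Num.sqrt s < m.
  rewrite -[ltRHS]ger0_norm// -sqrtr_sqr ltr_sqrt ?exprn_gt0//.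
  by rewrite gtrBl divr_gt0 ?exprn_gt0.
suff : m <= Num.sqrt s by rewrite leNgt ms.
apply/(opnorm_le Qb); first exact: sqrtr_ge0.
move=> x; rewrite -(ler_pXn2r (n := 2)) ?nnegrE ?mulr_ge0 ?rnorm_ge0 ?sqrtr_ge0//.
have -> : (Num.sqrt s * rnorm x) ^+ 2 = Num.max s 0 * rnorm x ^+ 2.
  rewrite exprMn; congr (_ * _); case: (leP 0 s) => s0.
    by rewrite sqr_sqrtr// max_l.
  by rewrite ler0_sqrtr ?expr0n//= ?max_r// ltW.
apply: le_trans (_ : s * rnorm x ^+ 2 <= _); last first.
  by rewrite ler_wpM2r ?sqr_ge0// le_max lexx.
rewrite -(ler_pM2l (exprn_gt0 2 m_gt0)) /s.
have -> : m ^+ 2 * ((m ^+ 2 - d ^+ 2 / m ^+ 2) * rnorm x ^+ 2) =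
  m ^+ 4 * rnorm x ^+ 2 - d ^+ 2 * rnorm x ^+ 2 by field; rewrite gt_eqF.
by have := key x; lra.
Qed.

(** Applied to [p = X]: the polynomial [X^2 - m^2] is nonzero whatever [m] is, so
    it has a root in the spectrum. *)
Lemma spectrum_neq0 A : bounded_op A -> selfadjoint A ->
  (exists u : H, u != 0) -> real_spectrum A !=set0.
Proof.
move=> Ab As u; have P := opnorm_not_bounded_below (p := 'X) Ab As u.
have [|r rA _] := root_in_spectrum Ab As _ P; last by exists r.
by rewrite -size_poly_gt0 size_XnsubC.
Qed.

Lemma opnorm_attained p A : bounded_op A -> selfadjoint A ->
  (exists u : H, u != 0) ->
  exists2 r, real_spectrum A r & `|p.[r]| = opnorm (poly_op p A).
Proof.
move=> Ab As u; set m := opnorm _.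
have m0 : 0 <= m by exact/opnorm_ge0/rbounded_poly_op/bounded_op_rbounded.
suff [r rA /rootP] : exists2 r, real_spectrum A r & root (p ^+ 2 - (m ^+ 2)%:P) r.
  rewrite !hornerE => /eqP; rewrite subr_eq0 => /eqP pr; exists r => //.
  by rewrite -sqrtr_sqr pr sqrtr_sqr ger0_norm.
(* If [p ^+ 2] is the constant [m ^+ 2], any point of the spectrum will do. *)
have [->|] := eqVneq (p ^+ 2 - (m ^+ 2)%:P) 0.
  by have [r rA] := spectrum_neq0 Ab As u; exists r; rewrite ?root0.
by move=> /(root_in_spectrum Ab As); apply; exact: opnorm_not_bounded_below.
Qed.

(** Write [p - p(x) = q (X - x)].  Then [|p(x)| |u|] is at most
    [|p(A) u| + |q(A)| |(A - x) u|], so [|p(x)| > opnorm (p(A))] would make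
    [A - x] bounded below. *)
Lemma norm_horner_le_opnorm p A x : bounded_op A -> selfadjoint A ->
  real_spectrum A x -> `|p.[x]| <= opnorm (poly_op p A).
Proof.
move=> Ab As /(real_spectrumP x Ab As); rewrite leNgt => Ax; apply/negP => mp.
apply: Ax; have Abr := bounded_op_rbounded Ab.
have Qm : forall u, rnorm (poly_op p A u) <= opnorm (poly_op p A) * rnorm u.
  apply/opnorm_le => //; first exact: rbounded_poly_op.
  exact/opnorm_ge0/rbounded_poly_op.
have /factor_theorem[q pE] : root (p - p.[x]%:P) x.
  by rewrite rootE !hornerE subrr.
have [N N0 qN] := rbounded_poly_op q Abr.
exists ((`|p.[x]| - opnorm (poly_op p A)) / N) => [|u].
  by rewrite divr_gt0// subr_gt0.
rewrite mulrAC ler_pdivrMr// mulrBl [leRHS]mulrC.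
have E : poly_op q A (A u - x%:C *: u) = poly_op p A u - p.[x]%:C *: u.
  have -> : A u - x%:C *: u = poly_op ('X - x%:P) A u.
    by rewrite -polyCN poly_opD poly_opC poly_opX rmorphN scaleNr.
  by rewrite -poly_opM -pE -polyCN poly_opD poly_opC rmorphN scaleNr.
apply: le_trans (qN _); rewrite E lerBlDr -rnormZr.
apply: le_trans (_ : _ <= rnorm (poly_op p A u - p.[x]%:C *: u) +
  rnorm (poly_op p A u)) _; last by rewrite lerD2l.
rewrite -[X in rnorm X](subrK (poly_op p A u)) (le_trans (rnormD _ _))//.
by rewrite lerD2r -rnormN opprB.
Qed.

(** Testing against all [c >= 0], rather than equating the norm with a supremum,
    also covers the zero space, whose spectrum is empty. *)
Lemma opnorm_poly_op_le p A c : bounded_op A -> selfadjoint A -> 0 <= c ->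
  opnorm (poly_op p A) <= c <-> forall x, real_spectrum A x -> `|p.[x]| <= c.
Proof.
move=> Ab As c0; split=> [pc x xA|pc].
  by rewrite (le_trans _ pc)// norm_horner_le_opnorm.
have [u|H0] := pselect (exists u : H, u != 0).
  by have [r rA <-] := opnorm_attained p Ab As u; exact: pc.
apply/opnorm_le => //; first exact/rbounded_poly_op/bounded_op_rbounded.
move=> x; have -> : x = 0 by apply: contrapT => /eqP x0; apply: H0; exists x.
by rewrite linear0 rnorm0 mulr0.
Qed.

End SpectralNorm.

(** * Vietoris continuity *)

Section VietorisTopology.
Variables (X T : topologicalType).

Lemma vietoris_nbhsP (F : closed_subset X) (W : set (closed_subset X)) :
  nbhs F W <-> exists KO, [/\ vietoris_index KO, vietoris_base KO F &
    vietoris_base KO `<=` W].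
Proof.
rewrite nbhsE; split=> [[_ [[D DI <-] [i Di Fi] DW]]|[i [iI Fi iW]]].
  by exists i; split=> //; [exact: DI|move=> G Gi; apply: DW; exists i].
exists (vietoris_base i) => //; split=> //.
exists [set i] => [_ ->//|]; by rewrite bigcup_set1.
Qed.

End VietorisTopology.

Section SemiContinuity.
Variables (X T : topologicalType).
Implicit Types (F : T -> set X).

(** Lower semicontinuity of the set-valued map [F]. *)
Definition hits_near F (t0 : T) := forall O, open O -> F t0 `&` O !=set0 ->
  \forall t \near t0, F t `&` O !=set0.

(** Upper semicontinuity of the set-valued map [F]. *)
Definition misses_near F (t0 : T) := forall K, closed K -> K `&` F t0 = set0 ->
  \forall t \near t0, K `&` F t = set0.

(** A base element is a finite intersection of such conditions. *)
Lemma vietoris_continuousP (F : T -> closed_subset X) t0 :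
  {for t0, continuous F} <-> hits_near F t0 /\ misses_near F t0.
Proof.
split=> [Fc|[hit miss] W /vietoris_nbhsP[[K Os] [[/= cK fO oO] [/= KF OF] sW]]].
  split=> [V oV FV|K cK KF].
    have : nbhs (F t0) [set G : closed_subset X | G `&` V !=set0].
      apply/vietoris_nbhsP; exists (set0, [set V]); split=> /=.
      - by split=> /=; [exact: closed0|exact: finite_set1|move=> _ ->].
      - by split=> /=; [rewrite set0I|move=> _ ->].
      - by move=> G [_ /= GV]; exact: GV.
    by move=> /Fc.
  have : nbhs (F t0) [set G : closed_subset X | K `&` G = set0].
    apply/vietoris_nbhsP; exists (K, set0); split=> /=.
    - by split=> //=; exact: finite_set0.
    - by split.
    - by move=> G [].
  by move=> /Fc.
have [D DE] := finite_fsetP.1 fO.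
have hitO : \forall t \near t0, forall O, Os O -> F t `&` O !=set0.
  have : nbhs t0 (\bigcap_(O in Os) [set t | F t `&` O !=set0]).
    rewrite DE; apply: filter_bigI => O OD; have OsO : Os O by rewrite DE.
    by apply: hit; [exact: oO|exact: OF].
  by apply: filterS => t Ot O OsO; exact: Ot.
have := miss K cK KF; move: hitO; apply: filterS2 => t Ot Kt.
by apply: sW; split=> [|O OsO]; [exact: Kt|exact: Ot].
Qed.

End SemiContinuity.

(** * Continuity of the extremities *)

Section ExtremalEdges.
Variables (R : realType) (T : topologicalType).
Implicit Types (F : T -> set R) (f : T -> \bar R) (S : set R).

Lemma ereal_continuousP f t0 : {for t0, continuous f} <->
  (forall a : R, (a%:E < f t0)%E -> \forall t \near t0, (a%:E < f t)%E) /\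
  (forall a : R, (f t0 < a%:E)%E -> \forall t \near t0, (f t < a%:E)%E).
Proof.
split=> [fc|[fgt flt]].
  split=> a af; first exact: (fc _ (open_ereal_gt' af)).
  exact: (fc _ (open_ereal_lt' af)).
rewrite /prop_for /continuous_at; case E : (f t0) => [r| |].
- move=> W [e /= e0 eW].
  have /fgt : ((r - e)%:E < f t0)%E by rewrite E lte_fin gtrBl.
  have /flt : (f t0 < (r + e)%:E)%E by rewrite E lte_fin ltrDl.
  apply: filterS2 => t; rewrite /=.
  case: (f t) => [s| |]; rewrite ?lte_fin ?ltNyr//.
  by move=> sr rs; apply: (eW s); rewrite /= distrC ltr_distl rs sr.
- by apply/cvgeyPgt => a; apply: fgt; rewrite E ltry.
- by apply/cvgeNyPlt => a; apply: flt; rewrite E ltNyr.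
Qed.

Lemma lt_ereal_sup S c :
  (c%:E < ereal_sup [set x%:E | x in S])%E <-> exists2 x, S x & c < x.
Proof.
split=> [/ereal_sup_gt[_ [x Sx <-]]|[x Sx cx]].
  by rewrite lte_fin => cx; exists x.
have : (x%:E <= ereal_sup [set x%:E | x in S])%E.
  by apply: ereal_sup_ubound; exists x.
by apply: lt_le_trans; rewrite lte_fin.
Qed.

Lemma ereal_sup_lt S c : (ereal_sup [set x%:E | x in S] < c%:E)%E <->
  exists2 d, d < c & forall x, S x -> x <= d.
Proof.
split=> [Sc|[d dc Sd]]; last first.
  apply: le_lt_trans (_ : _ <= d%:E)%E _; last by rewrite lte_fin.
  by apply: ge_ereal_sup => _ [x Sx <-]; rewrite lee_fin Sd.
have Sle x : S x -> (x%:E <= ereal_sup [set x%:E | x in S])%E.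
  by move=> Sx; apply: ereal_sup_ubound; exists x.
move: Sc Sle; case: (ereal_sup _) => [r| |] //.
  by rewrite lte_fin => rc Sr; exists r => // x /Sr; rewrite lee_fin.
move=> _ SN; exists (c - 1); first by rewrite gtrBl.
by move=> x /SN; rewrite leeNy_eq.
Qed.

(** Speaking of upper bounds [d < c], and not of values of the supremum, treats
    the supremum [-oo] of an empty set like the others. *)
Lemma sup_continuousP F t0 :
  {for t0, continuous (fun t => ereal_sup [set x%:E | x in F t])} <->
  (forall c, F t0 `&` [set x | c < x] !=set0 ->
    \forall t \near t0, F t `&` [set x | c < x] !=set0) /\
  (forall c d, d < c -> (forall x, F t0 x -> x <= d) ->
    \forall t \near t0, exists2 d', d' < c & forall x, F t x -> x <= d').
Proof.
apply: (iff_trans (ereal_continuousP _ _)); split=> -[Fgt Flt]; split.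
- move=> c [x [Fx cx]]; have /lt_ereal_sup : exists2 x, F t0 x & c < x by exists x.
  by move=> /Fgt; apply: filterS => t /lt_ereal_sup[y Fy cy]; exists y.
- move=> c d dc Fd; have /ereal_sup_lt : exists2 d, d < c & forall x, F t0 x -> x <= d.
    by exists d.
  by move=> /Flt; apply: filterS => t /ereal_sup_lt.
- move=> c /lt_ereal_sup[x Fx cx]; have : F t0 `&` [set x | c < x] !=set0 by exists x.
  by move=> /Fgt; apply: filterS => t [y [Fy cy]]; apply/lt_ereal_sup; exists y.
- by move=> c /ereal_sup_lt[d dc] /(Flt c d dc); apply: filterS => t /ereal_sup_lt.
Qed.

(** Reflection about [0], which turns infima into suprema. *)
Definition mirror F t : set R := -%R @^-1` F t.

Lemma inf_continuousP F t0 :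
  {for t0, continuous (fun t => ereal_inf [set x%:E | x in F t])} <->
  {for t0, continuous (fun t => ereal_sup [set x%:E | x in mirror F t])}.
Proof.
have E t : ereal_sup [set x%:E | x in mirror F t] =
    (- ereal_inf [set x%:E | x in F t])%E.
  rewrite -ereal_supN; congr ereal_sup; apply/seteqP; split=> [_ [x Fx <-]|].
    by exists (- x)%:E; [exists (- x)|rewrite -EFinN opprK].
  by move=> _ [_ [x Fx <-] <-]; exists (- x); rewrite /mirror /= ?opprK.
rewrite (_ : (fun t => ereal_sup _) = (fun t => - ereal_inf [set x%:E | x in F t])%E).
  by apply: iff_sym; exact: cvgeNP.
exact/funext.
Qed.

Lemma hits_near_mirror F t0 : hits_near F t0 -> hits_near (mirror F) t0.
Proof.
move=> hit O oO [x [Fx Ox]].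
have oNO : open (-%R @^-1` O) by apply: open_comp => // y _; exact: opp_continuous.
have /(hit _ oNO) : F t0 `&` (-%R @^-1` O) !=set0 by exists (- x); rewrite /= opprK.
apply: filterS => t [y [Fy Oy]]; exists (- y); split=> //.
by rewrite /mirror /= opprK.
Qed.

Lemma misses_near_mirror F t0 : misses_near F t0 -> misses_near (mirror F) t0.
Proof.
move=> miss K cK KF.
have cNK : closed (-%R @^-1` K).
  exact: (preimage_closed (in1W (@opp_continuous _)) cK).
have /(miss _ cNK) : -%R @^-1` K `&` F t0 = set0.
  rewrite -subset0 => x [/= Kx Fx]; have : (K `&` mirror F t0) (- x).
    by split=> //; rewrite /mirror /= opprK.
  by rewrite KF.
apply: filterS => t; rewrite -!subset0 => KFt x [Kx Fx].
by apply: (KFt (- x)); rewrite /= opprK.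
Qed.

Lemma sup_continuous F t0 : hits_near F t0 -> misses_near F t0 ->
  {for t0, continuous (fun t => ereal_sup [set x%:E | x in F t])}.
Proof.
move=> hit miss; apply/sup_continuousP; split=> [c|c d dc Fd].
  exact/hit/open_gt.
pose e := (c + d) / 2.
have /(miss _ (@closed_ge R e)) : [set x | e <= x] `&` F t0 = set0.
  by rewrite -subset0 => x [/= ex /Fd]; rewrite /e in ex *; lra.
apply: filterS => t; rewrite -subset0 => FtK; exists e; first by rewrite /e; lra.
move=> x Fx; rewrite leNgt; apply/negP => ex; apply: (FtK x).
by split=> //=; exact: ltW.
Qed.

End ExtremalEdges.

(** * From Vietoris continuity to gap edges *)

Section GapsFromVietoris.
Variables (R : realType) (T : topologicalType).
Implicit Types (S : set R) (F : T -> set R).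

Lemma last_below S c x : closed S -> ~ S c -> S x -> x < c ->
  exists a, [/\ S a, x <= a, a < c & forall z, S z -> z < c -> z <= a].
Proof.
move=> cS Sc Sx xc; pose E := S `&` [set z | z <= c].
have E0 : E !=set0 by exists x; split=> //=; exact: ltW.
have Eub : has_ubound E by exists c => z [].
have cE : closed E by apply: closedI => //; exact: closed_le.
have [Sa ac] : E (sup E) by apply: cE; exact: closure_sup.
exists (sup E); split=> //.
- by apply: ub_le_sup => //; split=> //=; exact: ltW.
- by rewrite lt_neqAle ac andbT; apply: contra_notN Sc => /eqP <-.
- by move=> z Sz zc; apply: ub_le_sup => //; split=> //=; exact: ltW.
Qed.

Lemma gap_around S c x y : closed S -> ~ S c -> S x -> S y -> x < c -> c < y ->
  exists a b, [/\ gap S a b, x <= a, a < c, c < b & b <= y].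
Proof.
move=> cS Sc Sx Sy xc cy.
have [a [Sa xa ac aP]] := last_below cS Sc Sx xc.
have cNS : closed (-%R @^-1` S).
  exact: (preimage_closed (in1W (@opp_continuous _)) cS).
have [|||b [Sb yb bc bP]] := @last_below (-%R @^-1` S) (- c) (- y) cNS.
- by rewrite /= opprK.
- by rewrite /= opprK.
- by rewrite ltrN2.
exists a, (- b); split=> //; [|by rewrite ltrNr|by rewrite lerNl].
split=> //; first by rewrite (lt_trans ac)// ltrNr.
rewrite -subset0 => z [/=]; rewrite in_itv /= => /andP[az zb] Sz.
have [zc|cz|zc] := ltgtP z c; last by apply: Sc; rewrite -zc.
  by have := aP z Sz zc; rewrite leNgt az.
have /bP : (-%R @^-1` S) (- z) by rewrite /= opprK.
by rewrite ltrN2 lerNl leNgt zb => /(_ cz).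
Qed.

Lemma gap_notin S a b x : gap S a b -> a < x -> x < b -> ~ S x.
Proof.
move=> [_ _ _ abS] ax xb Sx; suff : (`]a, b[ `&` S) x by rewrite abS.
by split=> //=; rewrite in_itv /= ax.
Qed.

(** For [t] near [t0], the set [F t] meets small windows around [a] and [b] and
    misses the segment between them; its gap around the midpoint then has its
    ends in these windows. *)
Lemma gaps_open F t0 a b (e : R) : (forall t, closed (F t)) ->
  hits_near F t0 -> misses_near F t0 -> gap (F t0) a b -> 0 < e ->
  \forall t \near t0, exists a' b',
    [/\ gap (F t) a' b', `|a - a'| < e & `|b - b'| < e].
Proof.
move=> cF hit miss abF e0; have [ab Fa Fb _] := abF.
(* [d] keeps the windows around [a] and [b] away from the midpoint. *)
pose d := Num.min e ((b - a) / 4).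
have d0 : 0 < d by rewrite lt_min e0 divr_gt0 ?subr_gt0.
have de : d <= e by rewrite ge_min lexx.
have dab : d <= (b - a) / 4 by rewrite ge_min lexx orbT.
have hitab c : F t0 c -> \forall t \near t0, exists2 z, F t z & `|c - z| < d.
  move=> Fc; have /(hit _ (ball_open c d)) : F t0 `&` ball c d !=set0.
    by exists c; split=> //; exact: ballxx.
  by apply: filterS => t [z [Fz cz]]; exists z.
have : `[a + d, b - d] `&` F t0 = set0.
  rewrite -subset0 => z [/=]; rewrite in_itv /= => /andP[az zb].
  by apply: (gap_notin abF); lra.
move=> /(miss _ (@itv_closed _ R _ _)) Kt.
have := hitab a Fa; have := hitab b Fb; move: Kt; apply: filterS3.
move=> t Kt [y Fy]; rewrite ltr_distlC => /andP[y1 y2] [x Fx].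
rewrite ltr_distlC => /andP[x1 x2].
have Fad z : a + d <= z -> z <= b - d -> ~ F t z.
  move=> az zb Fz; suff : (`[a + d, b - d] `&` F t) z by rewrite Kt.
  by split=> //=; rewrite in_itv /= az.
have [|||a' [b' [abF' xa' a'm mb' b'y]]] :=
  @gap_around (F t) ((a + b) / 2) x y (cF t) _ Fx Fy.
- by apply: Fad; lra.
- lra.
- lra.
exists a', b'; split=> //; have [_ Fa' Fb' _] := abF'.
  have a'd : a' < a + d by rewrite ltNge; apply/negP => /Fad; apply => //; lra.
  by rewrite ltr_distlC; apply/andP; split; lra.
have b'd : b - d < b'.
  by rewrite ltNge; apply/negP => b'd; apply: (Fad b') => //; lra.
by rewrite ltr_distlC; apply/andP; split; lra.
Qed.

Lemma limit_in F t0 (U : set T) (a : T -> R) (l : R) : closed (F t0) ->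
  misses_near F t0 -> closure U t0 -> (forall t, U t -> F t (a t)) ->
  a t @[t --> within U (nbhs t0)] --> l -> F t0 l.
Proof.
move=> cF miss Ut0 Fa al; apply: contrapT => Fl.
have : open (~` F t0) by exact: closed_openC.
rewrite openE => /(_ l Fl)/nbhs_ballP[e /= e0 eF].
have /(miss _ (@itv_closed _ R _ _)) : `[l - e / 2, l + e / 2] `&` F t0 = set0.
  rewrite -subset0 => z [/=]; rewrite in_itv /= => /andP[lz zl] Fz.
  by apply: (eF z) => //; rewrite -ball_normE /= ltr_distlC; apply/andP; split; lra.
move=> /(cvg_within U).
have e2 : 0 < e / 2 by rewrite divr_gt0.
have /cvgrPdist_lt/(_ _ e2) := al.
have PF : ProperFilter (within U (nbhs t0)) by exact: within_nbhs_proper.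
have UU : within U (nbhs t0) U by exact: withinT.
move=> al2 Kt; near (within U (nbhs t0)) => t.
have Ut : U t by near: t.
have : `|l - a t| < e / 2 by near: t.
rewrite ltr_distlC => /andP[l1 l2].
suff : (`[l - e / 2, l + e / 2] `&` F t) (a t).
  have -> // : `[l - e / 2, l + e / 2] `&` F t = set0 by near: t.
by split; [rewrite /= in_itv /= !ltW|exact: Fa].
Unshelve. all: by end_near. Qed.

Lemma gap_edges_of_vietoris F t0 : (forall t, closed (F t)) ->
  hits_near F t0 -> misses_near F t0 -> gap_edges_continuous_at F t0.
Proof.
move=> cF hit miss; split; first split.
- exact: sup_continuous.
- apply/inf_continuousP/sup_continuous.
    exact: hits_near_mirror.
  exact: misses_near_mirror.
- move=> a b abF e e0; have := gaps_open cF hit miss abF e0.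
  rewrite /prop_near1 nbhsE => -[U [oU Ut0] UP]; exists U; split=> //.
move=> U a b Ut0 Ut0' Uab a0 b0 aa0 bb0.
have PF : ProperFilter (within U (nbhs t0)) by exact: within_nbhs_proper.
have Fa0 : F t0 a0 by apply: limit_in aa0 => // t /Uab[].
have Fb0 : F t0 b0 by apply: limit_in bb0 => // t /Uab[].
have : a0 <= b0.
  apply: ler_cvg_to aa0 bb0 _; apply: filterS (withinT U (nbhs_filter t0)).
  by move=> t /Uab[/ltW].
rewrite le_eqVlt => /orP[/eqP ab0|ab0]; [right|left]; split=> //.
  split=> //; exists U, a, b; split=> //; last by rewrite ab0.
  by have [t [Ut _]] := Ut0 setT filterT; exists t.
split=> //; rewrite -subset0 => x [/=]; rewrite in_itv /= => /andP[ax xb] Fx.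
pose d := Num.min (x - a0) (b0 - x) / 2.
have d0 : 0 < d by rewrite divr_gt0// lt_min !subr_gt0 ax.
have dx : 2 * d <= x - a0 by rewrite /d mulrC divfK// ge_min lexx.
have dy : 2 * d <= b0 - x by rewrite /d mulrC divfK// ge_min lexx orbT.
have /(hit _ (ball_open x d)) : F t0 `&` ball x d !=set0.
  by exists x; split=> //; exact: ballxx.
move=> /(cvg_within U) Fxd.
have /cvgrPdist_lt/(_ _ d0) ad := aa0; have /cvgrPdist_lt/(_ _ d0) bd := bb0.
have UU : within U (nbhs t0) U by exact: withinT.
near (within U (nbhs t0)) => t.
have Ut : U t by near: t.
have : `|a0 - a t| < d by near: t.
have : `|b0 - b t| < d by near: t.
have [z [Fz]] : F t `&` ball x d !=set0 by near: t.
rewrite -ball_normE /= !ltr_distlC => /andP[z1 z2] /andP[b1 b2] /andP[a1 a2].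
by apply: (gap_notin (Uab t Ut)) Fz; lra.
Unshelve. all: by end_near. Qed.

End GapsFromVietoris.

(** * From gap edges to Vietoris continuity *)

Section VietorisFromGaps.
Variables (R : realType) (T : topologicalType).
Implicit Types (F : T -> set R).

(** The filter along [U0] has a cluster value [l], and parameters [u n] in
    [V n] with [f (u n)] within [1 / (n + 1)] of [l] form the set sought.  Limits
    are taken along a set and not along a sequence, so each [u n] must be
    avoidable by a neighborhood of [t0]; this may fail as [T] is not assumed to
    be separated, but then a single point [s] belongs to every neighborhood of
    [t0], and [U = [set s]] works. *)
Lemma first_countable_convergent (t0 : T) (V : nat -> set T) (U0 : set T)
    (f : T -> R) (M : R) :
  (forall n, nbhs t0 (V n)) -> (forall N, nbhs t0 N -> exists n, V n `<=` N) ->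
  closure U0 t0 -> (forall t, U0 t -> `|f t| <= M) ->
  exists U l, [/\ U `<=` U0, closure U t0 &
    f t @[t --> within U (nbhs t0)] --> (l : R)].
Proof.
move=> Vt0 V0 U0t0 fM.
have [[s [U0s sN]]|U0N] := pselect (exists s, U0 s /\ forall N, nbhs t0 N -> N s).
  exists [set s], (f s); split=> [_ -> //|N Nt0|].
    by exists s; split=> //; exact: sN.
  apply: cvg_near_cst; apply: filterS (withinT [set s] (nbhs_filter t0)).
  by move=> _ ->.
have PF : ProperFilter (within U0 (nbhs t0)) by exact: within_nbhs_proper.
pose G := f t @[t --> within U0 (nbhs t0)].
have GM : G `[- M, M]%classic.
  apply: filterS (withinT U0 (nbhs_filter t0)) => t /fM.
  by rewrite /= in_itv /= ler_norml.
have [l [_ Gl]] := @segment_compact R (- M) M G _ GM.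
have uP n : exists t, [/\ U0 t, V n t & `|l - f t| < n.+1%:R^-1].
  have GV : G (f @` (U0 `&` V n)).
    by apply: filterS (Vt0 n) => t Vt U0t; exists t.
  have lB : nbhs l (ball l (n.+1%:R^-1 : R)).
    by apply: nbhsx_ballx; rewrite invr_gt0.
  by have [_ [[t [U0t Vt] <-] lt]] := Gl _ _ GV lB; exists t.
have [u {}uP] := choice uP.
exists (range u), l; split=> [_ [n _ <-]|N /V0[n VN]|].
- by have [] := uP n.
- by have [_ Vn _] := uP n; exists (u n); split; [exists n|exact: VN].
apply/cvgrPdist_lt => e e0.
pose n := Num.truncn e^-1.
have ne : n.+1%:R^-1 < e.
  by rewrite invf_plt ?posrE// truncnS_gt.
have : \forall t \near t0, forall i : 'I_n, t != u i.
  apply: filter_forall => i; have [U0u _ _] := uP i.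
  have [N Nt0 Nu] : exists2 N, nbhs t0 N & ~ N (u i).
    apply: contrapT => uN; apply: U0N; exists (u i); split=> // N Nt0.
    by apply: contrapT => Nu; apply: uN; exists N.
  by apply: filterS Nt0 => t Nt; apply/eqP => tu; apply: Nu; rewrite -tu.
apply: filterS => t tu [k _ kt].
have nk : (n <= k)%N.
  rewrite leqNgt; apply/negP => kn.
  by have := tu (Ordinal kn); rewrite -kt eqxx.
have [_ _ lk] := uP k; rewrite -kt (lt_trans lk)// (le_lt_trans _ ne)//.
by rewrite lef_pV2 ?posrE// ler_nat.
Qed.

Lemma near_mirror F (t0 : T) (x : R) :
  (\forall y \near - x & t \near t0, ~ mirror F t y) ->
  \forall y \near x & t \near t0, ~ F t y.
Proof.
move=> [[A B] [/= Ax Bt] AB]; exists (-%R @^-1` A, B).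
  by split=> //; exact: (@opp_continuous R x _ Ax).
move=> [y t] [/= Ay Bt'] Fy; apply: (AB (- y, t)) => //=.
by rewrite /mirror /= opprK.
Qed.

Lemma misses_above F t0 x : closed (F t0) -> F t0 !=set0 ->
  {for t0, continuous (fun t => ereal_sup [set x%:E | x in F t])} ->
  (forall y, F t0 y -> y < x) -> \forall y \near x & t \near t0, ~ F t y.
Proof.
move=> cF [z Fz] /sup_continuousP[_ Fsup] Fx.
have Fx' : ~ F t0 x by move=> /Fx; rewrite ltxx.
have [a [Fa _ ax aP]] := last_below cF Fx' Fz (Fx z Fz).
pose c := (a + x) / 2.
have /Fsup : a < c by rewrite /c; lra.
move=> /(_ (fun y Fy => aP y Fy (Fx y Fy))) Fc.
exists ([set y | c < y], [set t | exists2 d, d < c & forall x, F t x -> x <= d]).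
  split=> //=; apply: open_nbhs_nbhs; split; [exact: open_gt|rewrite /= /c; lra].
by move=> [y t] [/= cy [d dc Fd] /Fd]; lra.
Qed.

Lemma edges_bounded F t0 M :
  {for t0, continuous (fun t => ereal_sup [set x%:E | x in F t])} ->
  {for t0, continuous (fun t => ereal_inf [set x%:E | x in F t])} ->
  (forall x, F t0 x -> `|x| <= M) ->
  \forall t \near t0, forall x, F t x -> `|x| <= M + 1.
Proof.
move=> /sup_continuousP[_ Fsup] /inf_continuousP/sup_continuousP[_ Finf] FM.
have M1 : M < M + 1 by rewrite ltrDl.
have := Fsup _ _ M1 (fun x Fx => le_trans (ler_norm x) (FM x Fx)).
have FNM x : mirror F t0 x -> x <= M.
  by move=> /FM; rewrite normrN => /(le_trans (ler_norm x)).
have := Finf _ _ M1 FNM; apply: filterS2 => t [d dM Fd] [d' dM' Fd'] x Fx.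
have := Fd' x Fx; have /Fd : mirror F t (- x) by rewrite /mirror /= opprK.
by move=> xd xd'; rewrite ler_norml; apply/andP; split; lra.
Qed.

(** Locally around a point [x] outside [F t0], three situations may occur: [x]
    is above [F t0], below it, or in one of its gaps.  Continuity of the
    supremum, of the infimum or of that gap keeps a neighborhood of [x] outside
    [F t] for [t] near [t0]; compactness makes this uniform in [x]. *)
Lemma misses_of_gap_edges F t0 M : (forall t, closed (F t)) ->
  (forall x, F t0 x -> `|x| <= M) ->
  gap_edges_continuous_at F t0 -> misses_near F t0.
Proof.
move=> cF FM [[Fsup Finf] Fgap _] K cK KF.
have FK x : K x -> ~ F t0 x by move=> Kx Fx; suff : (K `&` F t0) x by rewrite KF.
have [F0|/set0P/negP/negPn/eqP F0] := pselect (F t0 !=set0); last first.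
  have /sup_continuousP[_ /(_ 0 (- 1))] := Fsup.
  move=> /(_ (ltrN10 R)); rewrite F0 => /(_ (fun _ => False_ind _)).
  move/inf_continuousP/sup_continuousP : Finf => [_ /(_ 0 (- 1))].
  move=> /(_ (ltrN10 R)); have NF0 x : ~ mirror F t0 x by rewrite /mirror /= F0.
  move=> /(_ (fun x Fx => False_ind _ (NF0 x Fx))).
  apply: filterS2 => t [d d0 Fd] [d' d'0 Fd']; rewrite -subset0 => x [_ Fx].
  have := Fd' x Fx; have /Fd : mirror F t (- x) by rewrite /mirror /= opprK.
  by lra.
have cptK : compact (K `&` `[- (M + 1), M + 1]).
  by rewrite setIC; apply: compact_closedI => //; exact: segment_compact.
have : \forall t \near t0, K `&` `[- (M + 1), M + 1] `<=` (fun x => ~ F t x).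
  move/compact_near_coveringP : cptK; apply => x [Kx _].
  have [[z Fz xz]|xF] := pselect (exists2 z, F t0 z & x < z); last first.
    apply: misses_above => // y Fy; rewrite ltNge le_eqVlt; apply/negP.
    move=> /orP[/eqP xy|xy]; last by apply: xF; exists y.
    by apply: (FK x Kx); rewrite xy.
  have [[y Fy yx]|xF] := pselect (exists2 y, F t0 y & y < x); last first.
    apply: near_mirror; apply: misses_above.
    - exact: (preimage_closed (in1W (@opp_continuous _)) (cF t0)).
    - by exists (- z); rewrite /mirror /= opprK.
    - exact/inf_continuousP.
    - move=> y Fy; rewrite ltrNr ltNge le_eqVlt; apply/negP.
      move=> /orP[/eqP xy|xy]; last by apply: xF; exists (- y).
      by apply: (FK x Kx); rewrite -xy.
  have [a [b [abF _ ax xb _]]] := gap_around (cF t0) (FK x Kx) Fy Fz yx xz.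
  pose e := Num.min (x - a) (b - x) / 2.
  have e0 : 0 < e by rewrite divr_gt0// lt_min !subr_gt0 ax.
  have ea : 2 * e <= x - a by rewrite /e mulrC divfK// ge_min lexx.
  have eb : 2 * e <= b - x by rewrite /e mulrC divfK// ge_min lexx orbT.
  have [U [oU Ut0 UP]] := Fgap a b abF e e0.
  exists (ball x e, U).
    by split=> /=; [exact: nbhsx_ballx|exact: open_nbhs_nbhs].
  move=> [y' t] [/=]; rewrite -ball_normE /= ltr_distlC => /andP[xy yx'] Ut.
  have [a' [b' [abF']]] := UP t Ut.
  rewrite !ltr_distlC => /andP[a1 a2] /andP[b1 b2].
  by apply: (gap_notin abF'); lra.
have := edges_bounded Fsup Finf FM; apply: filterS2 => t FtM KFt.
rewrite -subset0 => x [Kx Fx]; apply: (KFt x) => //; split=> //.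
by rewrite /= in_itv /= -ler_norml FtM.
Qed.

(** If [x] in [F t0] is not approached, the sets [F t] avoid a ball of radius [r]
    around [x] for parameters [t] accumulating at [t0].  By continuity of the
    extremities they have points on both sides of it, hence a gap containing it;
    along a suitable set of parameters these gaps converge, to a gap of [F t0]
    containing [x]. *)
Lemma hits_of_gap_edges F t0 M : first_countable T -> (forall t, closed (F t)) ->
  (forall x, F t0 x -> `|x| <= M) ->
  gap_edges_continuous_at F t0 -> hits_near F t0.
Proof.
move=> /(_ t0)[V [Vt0 V0]] cF FM [[Fsup Finf] _ Flim] O oO [x [Fx Ox]].
have [r r0 rO] : exists2 r : R, 0 < r & ball x r `<=` O.
  by move: oO; rewrite openE => /(_ x Ox)/nbhs_ballP.
apply: contrapT => nearO.
have far t y : ~ (F t `&` O !=set0) -> F t y -> y <= x - r \/ x + r <= y.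
  move=> FO Fy; have [|yx] := leP y (x - r); [by left|right].
  rewrite leNgt; apply/negP => xy; apply: FO; exists y; split=> //; apply: rO.
  by rewrite -ball_normE /= ltr_distlC yx.
pose sides t := [/\ F t `&` [set y | x - r < y] !=set0,
  F t `&` [set y | y < x + r] !=set0 & forall y, F t y -> `|y| <= M + 1].
have near_sides : \forall t \near t0, sides t.
  have /sup_continuousP[/(_ (x - r)) Fxr _] := Fsup.
  have /inf_continuousP/sup_continuousP[/(_ (- x - r)) Fxr' _] := Finf.
  have := edges_bounded Fsup Finf FM.
  have /Fxr : F t0 `&` [set y | x - r < y] !=set0 by exists x; split=> //=; lra.
  have /Fxr' : mirror F t0 `&` [set y | - x - r < y] !=set0.
    by exists (- x); split=> /=; [rewrite /mirror /= opprK|lra].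
  apply: filterS3 => t [y [Fy /= xy]] ? ?; split=> //.
  by exists (- y); split=> //=; lra.
pose U0 := [set t | sides t /\ ~ (F t `&` O !=set0)].
have U0t0 : closure U0 t0.
  move=> N Nt0; apply: contrapT => U0N; apply: nearO; move: near_sides Nt0.
  apply: filterS2 => t st Nt; apply: contrapT => FO; apply: U0N.
  by exists t.
have gapU0 t : exists ab : R * R, U0 t -> [/\ gap (F t) ab.1 ab.2,
    ab.1 <= x - r, x + r <= ab.2, `|ab.1| <= M + 1 & `|ab.2| <= M + 1].
  have [[[[y [Fy xy]] [z [Fz zx]] FtM] FO]|] := pselect (U0 t); last by exists (0, 0).
  have zxr : z <= x - r by case: (far t z FO Fz) => //; move: zx => /=; lra.
  have xry : x + r <= y by case: (far t y FO Fy) => //; move: xy => /=; lra.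
  have [|||a [b [abF _ ax xb _]]] := @gap_around _ (F t) x z y (cF t) _ Fz Fy.
  - by move=> Ftx; case: (far t x FO Ftx); lra.
  - lra.
  - lra.
  have [_ Fa Fb _] := abF; exists (a, b) => _; split=> //=; try exact: FtM.
    by case: (far t a FO Fa) => //; lra.
  by case: (far t b FO Fb) => //; lra.
have [ab abP] := choice gapU0.
have [t /abP[]|U1 [a0 [U10 U1t0 aa0]]] := @first_countable_convergent
  t0 V U0 (fun t => (ab t).1) (M + 1) Vt0 V0 U0t0.
  by [].
have [t /U10/abP[]|U2 [b0 [U21 U2t0 bb0]]] := @first_countable_convergent
  t0 V U1 (fun t => (ab t).2) (M + 1) Vt0 V0 U1t0.
  by [].
have {}aa0 : (ab t).1 @[t --> within U2 (nbhs t0)] --> a0.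
  move=> P /aa0; rewrite /within /nbhs /=; apply: filterS => t Pt U2t.
  exact: Pt (U21 t U2t).
have U20 t : U2 t -> U0 t by move=> /U21/U10.
have PF : ProperFilter (within U2 (nbhs t0)) by exact: within_nbhs_proper.
have ax : a0 <= x - r.
  apply: (cvgr_to_le aa0); apply: filterS (withinT U2 (nbhs_filter t0)).
  by move=> t /U20/abP[].
have xb : x + r <= b0.
  apply: (cvgr_to_ge bb0); apply: filterS (withinT U2 (nbhs_filter t0)).
  by move=> t /U20/abP[].
have U2t0' : ~ U2 t0 by move=> /U20[_]; apply; exists x.
have Ugap t : U2 t -> gap (F t) (ab t).1 (ab t).2 by move=> /U20/abP[].
have [[_ abF]|[ab0 _]] := Flim U2 _ _ U2t0 U2t0' Ugap a0 b0 aa0 bb0; last by lra.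
by apply: (gap_notin abF) Fx; lra.
Qed.

End VietorisFromGaps.

(** * Fields of self-adjoint operators *)

Section SpectralFields.
Variables (R : realType) (T : topologicalType) (H : T -> hilbertType R).
Variable A : forall t, {linear H t -> H t}.
Hypothesis Ab : forall t, bounded_op (A t).
Hypothesis As : forall t, selfadjoint (A t).

Local Notation F t := (real_spectrum (A t)).
Local Notation norm_op p t := (opnorm (poly_op p (A t))).

Lemma real_spectrum_bounded t x : F t x -> `|x| <= norm_op 'X t.
Proof.
move=> Fx; have := norm_horner_le_opnorm 'X (Ab t) (@As t) Fx.
by rewrite hornerX.
Qed.

Lemma norm_op_le p t c : 0 <= c ->
  norm_op p t <= c <-> forall x, F t x -> `|p.[x]| <= c.
Proof. by move=> c0; exact: opnorm_poly_op_le. Qed.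

Lemma norm_op_ge0 p t : 0 <= norm_op p t.
Proof. exact/opnorm_ge0/rbounded_poly_op/bounded_op_rbounded. Qed.

Lemma norm_op_continuous p t0 :
  hits_near (fun t => F t) t0 -> misses_near (fun t => F t) t0 ->
  {for t0, continuous (fun t => norm_op p t)}.
Proof.
move=> hit miss; apply/cvgrPdist_lt => e e0.
have norm_p : continuous (fun x => `|p.[x]|).
  by move=> x; apply: cvg_norm; exact: continuous_horner.
have e2 : 0 < e / 2 by rewrite divr_gt0.
have v0 := norm_op_ge0 p t0; set v := norm_op p t0 in v0 *.
have upper : \forall t \near t0, norm_op p t <= v + e / 2.
  pose K := [set x | v + e / 2 <= `|p.[x]|].
  have cK : closed K.
    exact: (preimage_closed (in1W norm_p) (@closed_ge R (v + e / 2))).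
  have /(miss _ cK) : K `&` F t0 = set0.
    rewrite -subset0 => x [Kx Fx]; have := (norm_op_le p t0 v0).1 (lexx v) x Fx.
    by move: Kx; rewrite /K /=; lra.
  apply: filterS => t; rewrite -subset0 => KF; apply/norm_op_le; first lra.
  by move=> x Fx; rewrite leNgt; apply/negP => /ltW px; exact: (KF x).
have lower : \forall t \near t0, v - e / 2 <= norm_op p t.
  have [ve|ve] := ltP (v - e / 2) 0.
    by apply: nearW => t; rewrite (le_trans (ltW ve))// norm_op_ge0.
  pose O := [set x | v - e / 2 < `|p.[x]|].
  have oO : open O.
    exact: (open_comp (in1W norm_p) (@open_gt R (v - e / 2))).
  have /(hit _ oO) : F t0 `&` O !=set0.
    apply: contrapT => FO; suff : v <= v - e / 2 by lra.
    apply/(norm_op_le p t0 ve) => x Fx; rewrite leNgt; apply/negP => px.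
    by apply: FO; exists x.
  apply: filterS => t [x [Fx /ltW Ox]]; apply: (le_trans Ox).
  by apply: (norm_op_le p t _).1 => //; exact: norm_op_ge0.
move: upper lower; apply: filterS2 => t tv vt.
by rewrite ltr_distlC; apply/andP; split; lra.
Qed.

(** On points at distance at most [sqrt C] from [x] this quadratic polynomial is
    nonnegative and decreases with the distance to [x]. *)
Definition peak (C x : R) : {poly R} := C%:P - ('X - x%:P) ^+ 2.

Lemma horner_peak C x y : (peak C x).[y] = C - (y - x) ^+ 2.
Proof. by rewrite /peak !hornerE. Qed.

Lemma size_peak C x : (size (peak C x) <= 3)%N.
Proof.
rewrite (leq_trans (size_polyD _ _))// geq_max size_polyN.
rewrite (leq_trans (size_polyC_leq1 C))//=.
by rewrite (leq_trans (size_poly_exp_leq _ _))// size_XsubC.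
Qed.

(** The term [N ^+ 2] makes [peak C x] nonnegative on the spectrum, whose points
    are within distance [N] of [x]; the term [r ^+ 2] makes the bound
    nonnegative. *)
Lemma peak_le t C x (r N : R) : 0 <= r -> C = N ^+ 2 + r ^+ 2 ->
  (forall y, F t y -> r <= `|y - x| <= N) -> norm_op (peak C x) t <= C - r ^+ 2.
Proof.
move=> r0 CE Fr; have sq y : (y - x) ^+ 2 = `|y - x| ^+ 2.
  by rewrite real_normK ?num_real.
apply/norm_op_le; first by rewrite CE addrK sqr_ge0.
move=> y /Fr/andP[ry yN]; rewrite horner_peak sq.
have rN2 : r ^+ 2 <= `|y - x| ^+ 2 by rewrite ler_pXn2r ?nnegrE.
have yN2 : `|y - x| ^+ 2 <= N ^+ 2.
  by rewrite ler_pXn2r ?nnegrE// (le_trans _ yN).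
by rewrite ger0_norm; have := sqr_ge0 r; lra.
Qed.

Hypothesis p2A : p2_continuous A.

Lemma spectrum_near_bounded t0 :
  \forall t \near t0, forall y, F t y -> `|y| <= norm_op 'X t0 + 1.
Proof.
have X3 : (size ('X : {poly R}) <= 3)%N by rewrite size_polyX.
have M1 : norm_op 'X t0 < norm_op 'X t0 + 1 by rewrite ltrDl.
have : \forall t \near t0, norm_op 'X t < norm_op 'X t0 + 1.
  exact: cvgr_lt _ (@p2A _ X3 t0) _ M1.
apply: filterS => t /ltW tM y Fy.
exact: le_trans (real_spectrum_bounded Fy) tM.
Qed.

(** The norm of [peak C x] is [C] at [t0], hence exceeds [C - r^2] nearby, which
    forces a point of the spectrum within distance [r] of [x]. *)
Lemma hits_of_p2 t0 : hits_near (fun t => F t) t0.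
Proof.
move=> O oO [x [Fx Ox]]; pose M := norm_op 'X t0.
have [r r0 rO] : exists2 r : R, 0 < r & ball x r `<=` O.
  by move: oO; rewrite openE => /(_ x Ox)/nbhs_ballP.
have xM : `|x| <= M := real_spectrum_bounded Fx.
pose N := 2 * M + 1; pose C := N ^+ 2 + r ^+ 2.
have C0 : 0 <= C by rewrite addr_ge0 ?sqr_ge0.
have Cr : C - r ^+ 2 < norm_op (peak C x) t0.
  have := (norm_op_le (peak C x) t0 (norm_op_ge0 _ _)).1 (lexx _) x Fx.
  rewrite horner_peak subrr expr0n subr0 ger0_norm//; apply: lt_le_trans.
  by rewrite gtrBl exprn_gt0.
have : \forall t \near t0, C - r ^+ 2 < norm_op (peak C x) t.
  exact: cvgr_gt _ (@p2A _ (size_peak C x) t0) _ Cr.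
have := spectrum_near_bounded t0; apply: filterS2 => t FtM Ct; apply: contrapT => FO.
suff : norm_op (peak C x) t <= C - r ^+ 2 by rewrite leNgt Ct.
apply: (@peak_le t C x r N) => // [|y Fy]; first exact: ltW.
apply/andP; split; last first.
  by rewrite (le_trans (ler_normB _ _))//; have := FtM y Fy; rewrite -/M /N; lra.
rewrite leNgt; apply/negP => yx; apply: FO; exists y; split=> //; apply: rO.
by rewrite -ball_normE /= distrC.
Qed.

(** Around a point [x] at distance at least [r] from the spectrum at [t0], the
    norm of [peak C x] stays below [C - (r / 2)^2] for nearby [t], which keeps
    the spectrum at [t] at distance more than [r / 2] from [x]. *)
Lemma misses_of_p2 t0 : misses_near (fun t => F t) t0.
Proof.
move=> K cK KF; pose M := norm_op 'X t0.
have cptK : compact (K `&` `[- (M + 1), M + 1]).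
  by rewrite setIC; apply: compact_closedI => //; exact: segment_compact.
have : \forall t \near t0, K `&` `[- (M + 1), M + 1] `<=` (fun x => ~ F t x).
  move/compact_near_coveringP : cptK; apply => x [Kx].
  rewrite /= in_itv /= -ler_norml => xM.
  have oF : open (~` F t0) by exact/closed_openC/closed_real_spectrum.
  have [r /= r0 rF] : exists2 r : R, 0 < r & ball x r `<=` ~` F t0.
    apply/nbhs_ballP; move: oF; rewrite openE; apply => Fx.
    by suff : (K `&` F t0) x by rewrite KF.
  pose N := 2 * M + 1; pose C := N ^+ 2 + r ^+ 2.
  have Cr : norm_op (peak C x) t0 < C - (r / 2) ^+ 2.
    apply: le_lt_trans (_ : _ <= C - r ^+ 2) _; last first.
      by rewrite ltrD2l ltrN2 expr_div_n; have := exprn_gt0 2 r0; lra.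
    apply: (@peak_le t0 C x r N) => // [|y Fy]; first exact: ltW.
    apply/andP; split; last first.
      rewrite (le_trans (ler_normB _ _))//; have := real_spectrum_bounded Fy.
      by rewrite -/M /N; lra.
    rewrite leNgt; apply/negP => yx; apply: (rF y) Fy.
    by rewrite -ball_normE /= distrC.
  have r2 : 0 < r / 2 by rewrite divr_gt0.
  exists (ball x (r / 2), [set t | norm_op (peak C x) t < C - (r / 2) ^+ 2]).
    split=> /=; first exact: nbhsx_ballx.
    exact: cvgr_lt _ (@p2A _ (size_peak C x) t0) _ Cr.
  move=> [y t] [/=]; rewrite -ball_normE /= distrC => yx Ct Fy.
  have := (norm_op_le (peak C x) t (norm_op_ge0 _ _)).1 (lexx _) y Fy.
  rewrite horner_peak => /(le_trans (ler_norm _)).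
  have : `|y - x| ^+ 2 < (r / 2) ^+ 2 by rewrite ltr_pXn2r ?nnegrE// ltW.
  by rewrite real_normK ?num_real//; clear KF; lra.
have := spectrum_near_bounded t0; apply: filterS2 => t FtM KFt.
rewrite -subset0 => x [Kx Fx]; apply: (KFt x) => //; split=> //.
by rewrite /= in_itv /= -ler_norml FtM.
Qed.

End SpectralFields.

Theorem theorem1 (R : realType) (T : topologicalType)
    (H : T -> hilbertType R) (A : forall t, {linear H t -> H t})
    (Abounded : forall t, bounded_op (A t))
    (Aselfadjoint : forall t, selfadjoint (A t)) :
  [/\ continuous (fun t => closed_spectrum (A t)) <-> p2_continuous A,
      continuous (fun t => closed_spectrum (A t)) ->
        gap_edges_continuous (fun t => real_spectrum (A t)) &
      first_countable T ->
        gap_edges_continuous (fun t => real_spectrum (A t)) ->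
        continuous (fun t => closed_spectrum (A t))].
Proof.
pose F t := real_spectrum (A t).
have cF t : closed (F t) by exact: closed_real_spectrum.
have FM t x : F t x -> `|x| <= opnorm (poly_op 'X (A t)).
  exact: real_spectrum_bounded.
have FP : continuous (fun t => closed_spectrum (A t)) <->
    forall t, hits_near F t /\ misses_near F t.
  have P t := vietoris_continuousP (fun t => closed_spectrum (A t)) t.
  by split=> Fc t; [exact: (P t).1 (Fc t)|exact: (P t).2 (Fc t)].
split.
- split=> [/FP Fc p _ t|p2A].
    by have [hit miss] := Fc t; exact: norm_op_continuous.
  by apply/FP => t; split; [exact: hits_of_p2|exact: misses_of_p2].
- by move=> /FP Fc t; have [hit miss] := Fc t; exact: gap_edges_of_vietoris.
- move=> T1 Fgap; apply/FP => t; split.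
    exact: hits_of_gap_edges (FM t) (Fgap t).
  exact: misses_of_gap_edges (FM t) (Fgap t).
Qed.
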